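(* Assume $Y(x,\xi_x)\in[0,1]$ for every $x\in\mathcal X$. For any constant optimality gap $\epsilon\in(0,1)$ and risk level $\delta\in(0,1)$, the algorithm $\mathrm{SOGAS}(\mathcal Q,\epsilon,\delta)$ outputs, with probability at least $1-\delta$, an $\epsilon$-optimal solution $\hat x^\star\in\mathcal X$, that is, $$y(\hat x^\star)\ge y(x^\star)-\epsilon .$$ Moreover, its query complexity (number of uses of $\mathcal Q$ and its inverse) is $\tilde O(\sqrt{|\mathcal X|})$, where $\tilde O(\cdot)$ suppresses polylogarithmic factors (and $\epsilon$ is treated as a fixed constant).
   Context: **Problem.** $\mathcal X$ is a finite nonempty set of solutions. For each $x\in\mathcal X$, $\xi_x$ is a random input with finite support in a set $\Xi$ and probability mass function $P(\xi_x)$; $Y:\mathcal X\times\Xi\to\mathbb R$ is a deterministic function; $y(x):=\mathbb E[Y(x,\xi_x)]$; $x^\star\in\arg\max_{x\in\mathcal X}y(x)$. **Quantum simulation oracle.** $\mathcal Q$ is a unitary on registers $\mathcal X,\xi,Y$ (possibly with omitted ancillas) with $\mathcal Q\sum_x\omega_x|x\rangle_{\mathcal X}|0\rangle_\xi|0\rangle_Y=\sum_x\omega_x|x\rangle_{\mathcal X}|\mathrm{data}_x\rangle_{\xi,Y}$ whenever $\sum_x|\omega_x|^2=1$, where $|\mathrm{data}_x\rangle_{\xi,Y}:=\sum_{\xi_x\in\Xi}\sqrt{P(\xi_x)}\,|\xi_x\rangle_\xi|Y(x,\xi_x)\rangle_Y$. $\mathcal Q_x$ denotes its restriction to solution $x$: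 $\mathcal Q_x|0\rangle_\xi|0\rangle_Y=|\mathrm{data}_x\rangle_{\xi,Y}$. Query complexity counts uses of $\mathcal Q$ and $\mathcal Q^{-1}$. **Known subroutine QAE** (quantum mean estimation). Given oracle access to a random variable $Z$ with mean $\mu$ and standard deviation at most $\sigma$, $\mathrm{QAE}(\tilde\epsilon,\tilde\delta)$ uses $O(\frac{\sigma}{\tilde\epsilon}\log\frac1{\tilde\delta})$ queries and outputs $\hat\mu$ with $\mathbb P(|\hat\mu-\mu|\le\tilde\epsilon)\ge1-\tilde\delta$. It can be run as a unitary (no intermediate measurement), and coherently for all $x$, conditioned on register $\mathcal X$. **FlagOracle$(\mathcal Q,\ell,\eta,\kappa)$.** Set $m=\lceil\log_2\frac1{2\eta}\rceil+2$ and $\alpha=\frac{\kappa^2}{4|\mathcal X|^3}$. Prepare $\frac1{\sqrt{|\mathcal X|}}\sum_x|x\rangle_{\mathcal X}|\mathrm{data}_x\rangle_{\xi,Y}|0\rangle_A|0\rangle_P|0\rangle_F$. Conditioned on $|x\rangle_{\mathcal X}$, apply $\mathrm{QAE}(2^{-m}/3,\alpha)$ to $\mathcal Q_x$, as a unitary acting on register $P$ (which includes its workspace) and leaving $|\mathrm{data}_x\rangle_{\xi,Y}$ unchanged, the estimate being stored in $P$. Coherently compare the estimate with the midpoint of $[\ell+\eta-2^{1-m},\ell+\eta-2^{-m}]$ and write into register $A$ the bit $1$ if the estimate is closer to the right endpoint, $0$ otherwise. Apply a CNOT with control $A$ and target $F$. The result is a quantum procedure $\mathcal A$ with output state $|\phi(\mathcal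 A)\rangle$. Let $\Pi_F$ be the projector onto $F=1$, $p^{\mathrm{label}}=\|\Pi_F|\phi(\mathcal A)\rangle\|^2$, and $T_{\mathcal A}$ the query complexity of $\mathcal A$. **Known subroutine Amplify$(\mathcal A,\tilde\delta)$** (amplitude amplification). Uses $O\big(\frac{T_{\mathcal A}}{\sqrt{p^{\mathrm{label}}}}\log\frac1{\tilde\delta}\big)$ queries and, with probability at least $1-\tilde\delta$, prepares the normalized state $\Pi_F|\phi(\mathcal A)\rangle/\|\Pi_F|\phi(\mathcal A)\rangle\|$; it outputs the result of measuring register $\mathcal X$. **Known subroutine Estimate$(\mathcal A,\varepsilon,\tilde\delta)$** (amplitude estimation). Uses $O\big(\frac{T_{\mathcal A}}{\varepsilon\sqrt{p^{\mathrm{label}}}}\log\frac1{\tilde\delta}\big)$ queries and outputs $r$ with $|r-p^{\mathrm{label}}|\le\varepsilon p^{\mathrm{label}}$ with probability at least $1-\tilde\delta$. **OptimalRegion$(\mathcal Q,\epsilon,\delta')$.** Start with $\mathcal R_0=[0,1]$, $t=0$. While $|\mathcal R_t|\ge\epsilon/2$ ($|\cdot|$ is interval length): write $\mathcal R_t=[a_t,b_t]$, $\eta_t=(b_t-a_t)/4$, $\ell_t=(a_t+b_t)/2$, $\delta_t=\delta'/2^{t+1}$; let $\bar{\mathcal Q}_t$ be the oracle $\mathcal Q$ augmented with one auxiliary solution $x_a$ with $y(x_a)=1$ (so the solution set is $\mathcal X\cup\{x_a\}$, of size $|\mathcal X|+1$; a query to $\bar{\mathcal Q}_t$ costs $O(1)$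 queries to $\mathcal Q$); let $\mathcal A_t=\mathrm{FlagOracle}(\bar{\mathcal Q}_t,\ell_t,\eta_t,0.1\delta_t)$, $r_t=\mathrm{Estimate}(\mathcal A_t,0.1,\delta_t)$, $m_t=\lceil\log_2\frac1{2\eta_t}\rceil+2$. If $r_t>\frac{3}{2(|\mathcal X|+1)}$ set $\mathcal R_{t+1}=[\ell_t+\eta_t-2^{1-m_t},\,b_t]$; otherwise set $\mathcal R_{t+1}=[a_t,\,\ell_t+\eta_t-2^{-m_t}]$. Increase $t$ by one. Return the final $\mathcal R_t$. **SOGAS$(\mathcal Q,\epsilon,\delta)$.** (1) $\mathcal R=[a,b]\leftarrow\mathrm{OptimalRegion}(\mathcal Q,\epsilon,\delta/2)$. (2) $\eta\leftarrow(b-a)/4$, $\ell\leftarrow a-\frac34\eta$. (3) $\mathcal A_{\mathrm{flag}}\leftarrow\mathrm{FlagOracle}(\mathcal Q,\ell,\eta,0.01\delta)$. (4) Return $\hat x^\star\leftarrow\mathrm{Amplify}(\mathcal A_{\mathrm{flag}},\delta/2)$. *)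

(* Defs.v *)
From HB Require Import structures.
From mathcomp Require Import all_boot all_order all_algebra.
From mathcomp Require Import complex finmap.
From mathcomp Require Import -(notations) monalg.
From mathcomp Require Import classical_sets reals ereal exp.

Set Implicit Arguments.
Unset Strict Implicit.
Unset Printing Implicit Defensive.

Import Order.TTheory GRing.Theory Num.Theory.
Local Open Scope ring_scope.

(* A pure state is a finitely supported family of complex amplitudes indexed
   by the basis states of a register, i.e. an element of the free C-module
   [malg B R[i]].  Basis types need not be finite, so that Xi and the values
   of Y label basis states directly; composite registers have product bases. *)
Section States.
Variable R : realType.
Implicit Types B : choiceType.

Definition vec B := malg B R[i].

Definition ket B (b : B) : vec B := mkmalgU b 1.

Definition abs2 (z : R[i]) : R := complex.Re z ^+ 2 + complex.Im z ^+ 2.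

Definition inner B (u v : vec B) : R[i] :=
  \sum_(b <- msupp u) (mcoeff b u)^* * mcoeff b v.

Definition sqnorm B (v : vec B) : R := \sum_(b <- msupp v) abs2 (mcoeff b v).

Definition lin_ext B B' (f : B -> vec B') (v : vec B) : vec B' :=
  \sum_(b <- msupp v) mcoeff b v *: f b.

Definition tensor B1 B2 (u : vec B1) (v : vec B2) : vec (B1 * B2)%type :=
  lin_ext (fun b1 => lin_ext (fun b2 => ket (b1, b2)) v) u.

Definition relabel B B' (f : B -> B') : vec B -> vec B' :=
  lin_ext (fun b => ket (f b)).

Record unitary B := Unitary {
  ufun :> vec B -> vec B;
  uinv : vec B -> vec B;
  ufun_linear : linear ufun;
  ufunK : cancel ufun uinv;
  uinvK : cancel uinv ufun;
  ufun_inner : forall u v, inner (ufun u) (ufun v) = inner u v }.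

Record qstate B := QState { qvec :> vec B; qvec_unit : sqnorm qvec = 1 }.

(* squared norm of the projection of v onto the basis states satisfying p *)
Definition proj_sqnorm B (p : pred B) (v : vec B) : R :=
  \sum_(b <- msupp v | p b) abs2 (mcoeff b v).

Lemma lin_extEw B B' (f : B -> vec B') (v : vec B) (d : {fset B}) :
  (msupp v `<=` d)%fset -> lin_ext f v = \sum_(b <- d) mcoeff b v *: f b.
Proof.
move=> sub; rewrite /lin_ext; apply: big_fset_incl => // b _ bv.
by rewrite (mcoeff_outdom bv) scale0r.
Qed.

Lemma lin_ext_linear B B' (f : B -> vec B') : linear (lin_ext f).
Proof.
move=> c u v; set d := (msupp u `|` msupp v `|` msupp (c *: u + v))%fset.
rewrite !(@lin_extEw _ _ f _ d) ?fsubsetUr //.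
- rewrite scaler_sumr -big_split /=; apply: eq_bigr => b _.
  by rewrite mcoeffD mcoeffZ scalerDl scalerA.
- by apply: fsubset_trans (fsubsetUl _ _); apply: fsubsetUr.
- by apply: fsubset_trans (fsubsetUl _ _); apply: fsubsetUl.
Qed.

Lemma mcoeff_relabel B (f : B -> B) (fK : involutive f) (v : vec B) b :
  mcoeff b (relabel f v) = mcoeff (f b) v.
Proof.
rewrite /relabel /lin_ext raddf_sum /=.
under eq_bigr => b' _ do rewrite mcoeffZ mcoeffU.
have [fbv|fbv] := boolP (f b \in msupp v).
  rewrite (big_fsetD1 (f b)) //= fK eqxx mulr1 big1_seq ?addr0 // => b'.
  rewrite andTb !inE => /andP[b'fb _].
  case: eqP => [e|_]; last by rewrite mulr0.
  by rewrite -e fK eqxx in b'fb.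
rewrite (mcoeff_outdom fbv) big1_seq // => b' /andP[_ b'v].
case: eqP => [e|_]; last by rewrite mulr0.
by rewrite -e fK b'v in fbv.
Qed.

Lemma innerEw B (u v : vec B) (d : {fset B}) :
  (msupp u `<=` d)%fset ->
  inner u v = \sum_(b <- d) (mcoeff b u)^* * mcoeff b v.
Proof.
move=> sub; rewrite /inner; apply: big_fset_incl => // b _ bu.
by rewrite (mcoeff_outdom bu) conjC0 mul0r.
Qed.

Lemma relabelK B (f : B -> B) (fK : involutive f) :
  cancel (relabel f) (relabel f).
Proof. by move=> v; apply/malgP => b; rewrite !mcoeff_relabel // fK. Qed.

Lemma relabel_inner B (f : B -> B) (fK : involutive f) (u v : vec B) :
  inner (relabel f u) (relabel f v) = inner u v.
Proof.
have sub : (msupp (relabel f u) `<=` f @` msupp u)%fset.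
  apply/fsubsetP => b; rewrite -mcoeff_neq0 mcoeff_relabel // mcoeff_neq0 => h.
  by apply/imfsetP; exists (f b) => //; rewrite fK.
rewrite (innerEw _ sub) big_imfset /=; last first.
  by move=> x y _ _; apply: (can_inj fK).
by rewrite /inner; apply: eq_bigr => b _; rewrite !mcoeff_relabel // fK.
Qed.

Definition perm_unitary B (f : B -> B) (fK : involutive f) : unitary B :=
  Unitary (lin_ext_linear _) (relabelK fK) (relabelK fK) (relabel_inner fK).

End States.
Arguments ket {R B} b.

Section UniformState.
Variable R : realType.

Definition uniform_vec (X : finType) (B : choiceType) (f : X -> B) : vec R B :=
  \sum_x ((Num.sqrt (#|X|%:R : R))^-1)%:C%C *: ket (f x).

Lemma mcoeff_uniform (X : finType) (B : choiceType) (f : X -> B)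
    (f_inj : injective f) (x : X) :
  mcoeff (f x) (uniform_vec f) = ((Num.sqrt (#|X|%:R : R))^-1)%:C%C.
Proof.
rewrite /uniform_vec raddf_sum /= (bigD1 x) //= mcoeffZ mcoeffU eqxx mulr1.
rewrite big1 ?addr0 // => y yx; rewrite mcoeffZ mcoeffU.
case: eqP => [/f_inj e|_]; last by rewrite mulr0.
by rewrite e eqxx in yx.
Qed.

Lemma uniform_unit (X : finType) (B : choiceType) (f : X -> B) :
  (0 < #|X|)%N -> injective f -> sqnorm (uniform_vec f) = 1.
Proof.
move=> X0 f_inj; pose d := [fset f x | x in X]%fset.
have sub : (msupp (uniform_vec f) `<=` d)%fset.
  apply/fsubsetP => b; apply: contraLR => bd.
  rewrite -mcoeff_eq0 /uniform_vec raddf_sum /= big1 // => x _.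
  rewrite mcoeffZ mcoeffU; case: eqP => [e|_]; last by rewrite mulr0.
  by case/negP: bd; apply/imfsetP; exists x.
have -> : sqnorm (uniform_vec f) =
    \sum_(b <- d) abs2 (mcoeff b (uniform_vec f)).
  apply: big_fset_incl => // b _ bv.
  by rewrite (mcoeff_outdom bv) /abs2 /= expr0n addr0.
rewrite big_imfset /=; last by move=> x y _ _; apply: f_inj.
rewrite big_enum /= (eq_bigr (fun=> (#|X|%:R : R)^-1)); last first.
  move=> x _; rewrite mcoeff_uniform // /abs2 /= expr0n addr0 exprVn.
  by rewrite sqr_sqrtr ?ler0n.
by rewrite sumr_const -[LHS]mulr_natl divff // pnatr_eq0 -lt0n.
Qed.

Definition uniform_state (X : finType) (B : choiceType) (f : X -> B)
    (X_gt0 : (0 < #|X|)%N) (f_inj : injective f) : qstate R B :=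
  QState (uniform_unit X_gt0 f_inj).

End UniformState.

Section Problem.
Variables (R : realType) (X : finType) (Xi : choiceType).

Record problem := Problem {
  pmf : X -> malg Xi R;
  Yfun : X -> Xi -> R;
  pmf_ge0 : forall x xi, 0 <= mcoeff xi (pmf x);
  pmf_sum1 : forall x, \sum_(xi <- msupp (pmf x)) mcoeff xi (pmf x) = 1 }.

Variable I : problem.

Definition mean (x : X) : R :=
  \sum_(xi <- msupp (pmf I x)) mcoeff xi (pmf I x) * Yfun I x xi.

Definition stddev (x : X) : R :=
  Num.sqrt (\sum_(xi <- msupp (pmf I x))
              mcoeff xi (pmf I x) * (Yfun I x xi - mean x) ^+ 2).

(* basis of the registers X, xi, Y *)
Definition regs : choiceType := (X * (Xi * R))%type.

Definition data (x : X) : vec R (Xi * R)%type :=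
  \sum_(xi <- msupp (pmf I x))
    (Num.sqrt (mcoeff xi (pmf I x)))%:C%C *: ket (xi, Yfun I x xi).

(* |0>_xi |0>_Y is the basis state labelled by (xi0, 0). *)
Definition simulation_oracle (xi0 : Xi) (Q : unitary R regs) : Prop :=
  forall omega : X -> R[i], \sum_x abs2 (omega x) = 1 ->
    Q (\sum_x omega x *: ket (x, (xi0, 0))) =
    \sum_x omega x *: tensor (ket x) (data x).

Lemma augment_ge0 (xi0 : Xi) (x : option X) xi :
  0 <= mcoeff xi (if x is Some x' then pmf I x' else mkmalgU xi0 (1 : R)).
Proof.
case: x => [x|]; first exact: pmf_ge0.
by rewrite mcoeffU mulrn_wge0 ?ler01.
Qed.

Lemma augment_sum1 (xi0 : Xi) (x : option X) :
  let p := if x is Some x' then pmf I x' else mkmalgU xi0 (1 : R) in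
  \sum_(xi <- msupp p) mcoeff xi p = 1.
Proof.
case: x => [x|] /=; first exact: pmf_sum1.
by rewrite msuppU oner_eq0 big_seq_fset1 mcoeffUU.
Qed.

End Problem.

(* [None] is the auxiliary solution; its output is identically 1. *)
Definition augment (R : realType) (X : finType) (Xi : choiceType) (xi0 : Xi)
    (I : problem R X Xi) : problem R (option X) Xi :=
  @Problem R (option X) Xi
    (fun x => if x is Some x' then pmf I x' else mkmalgU xi0 1)
    (fun x xi => if x is Some x' then Yfun I x' xi else 1)
    (augment_ge0 I xi0) (augment_sum1 I xi0).

Section Wirings.
Variable R : realType.
Implicit Types B W : choiceType.

(* an identification of a composite register with a product of factors *)
Record wiring (B B' : Type) := Wiring {
  wire : B -> B'; unwire : B' -> B;
  wireK : cancel wire unwire; unwireK : cancel unwire wire }.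

(* U acting on the factor B1 of B, tensored with the identity on W *)
Definition apply_on B B1 W (w : wiring B (B1 * W))
    (U : vec R B1 -> vec R B1) : vec R B -> vec R B :=
  lin_ext (fun b =>
    relabel (unwire w) (tensor (U (ket (wire w b).1)) (ket (wire w b).2))).

Section Composition.
Variables (B B1 W B2 W2 : Type).
Variables (w : wiring B (B1 * W)) (w2 : wiring B1 (B2 * W2)).

Definition wcomp_wire (b : B) : B2 * (W2 * W) :=
  let b1 := wire w b in
  let b2 := wire w2 b1.1 in
  (b2.1, (b2.2, b1.2)).

Definition wcomp_unwire (b : B2 * (W2 * W)) : B :=
  unwire w (unwire w2 (b.1, b.2.1), b.2.2).

Lemma wcomp_wireK : cancel wcomp_wire wcomp_unwire.
Proof.
move=> b; rewrite /wcomp_unwire /wcomp_wire /= -surjective_pairing wireK.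
by rewrite -surjective_pairing wireK.
Qed.

Lemma wcomp_unwireK : cancel wcomp_unwire wcomp_wire.
Proof. by move=> [b [c d]]; rewrite /wcomp_wire unwireK /= unwireK. Qed.

Definition wcomp : wiring B (B2 * (W2 * W)) :=
  Wiring wcomp_wireK wcomp_unwireK.

End Composition.
End Wirings.

Section Circuits.
Variables (R : realType) (X : finType) (Xi : choiceType).
Variable Q : unitary R (regs R X Xi).

(* One step of a circuit on the register B with black-box access to an oracle
   on [regs R X Xi]: a gate that does not depend on the oracle, or one use of
   the oracle, or of its inverse if [inv]. *)
Inductive step (B : choiceType) :=
| Gate (B1 W : choiceType) (w : wiring B (B1 * W)) (U : unitary R B1)
| Query (W : choiceType) (w : wiring B (regs R X Xi * W)) (inv : bool).

Definition circuit (B : choiceType) := seq (step B).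

Definition is_query B (s : step B) : bool :=
  if s is Query _ _ _ then true else false.

Definition queries B (c : circuit B) : nat := count (@is_query B) c.

Definition run_step B (v : vec R B) (s : step B) : vec R B :=
  match s with
  | Gate B1 W w U => apply_on w U v
  | Query W w inv => apply_on w (if inv then uinv Q else ufun Q) v
  end.

Definition run_circuit B (c : circuit B) (v : vec R B) : vec R B :=
  foldl (@run_step B) v c.

(* the circuit c on B1, run on the factor B1 of B *)
Definition lift_circuit (B B1 W : choiceType) (w : wiring B (B1 * W))
    (c : circuit B1) : circuit B :=
  map (fun s => match s with
    | Gate B2 W2 w2 U => @Gate B B2 (W2 * W)%type (wcomp w w2) U
    | Query W2 w2 inv => @Query B (W2 * W)%type (wcomp w w2) inv
    end) c.

End Circuits.

Section Programs.
Variable R : realType.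

(* A finitely supported (sub)distribution on pairs of a result and the number
   of queries used, as a list of weighted outcomes. *)
Definition cdist (T : Type) := seq (R * (T * nat)).

Definition cret T (x : T) : cdist T := [:: (1, (x, 0%N))].

Definition cbind T U (d : cdist T) (f : T -> cdist U) : cdist U :=
  flatten [seq [seq (w.1 * r.1, (r.2.1, (w.2.2 + r.2.2)%N)) | r <- f w.2.1]
          | w <- d].

(* each query of d is charged as c queries *)
Definition charge T (c : nat) (d : cdist T) : cdist T :=
  [seq (w.1, (w.2.1, (c * w.2.2)%N)) | w <- d].

Definition prob T (d : cdist T) (E : pred (T * nat)) : R :=
  \sum_(w <- d | E w.2) w.1.

(* The number of rounds of an algorithm need not be bounded in advance.  Its
   law is represented by the subdistributions d n of the outcomes of the
   executions in which no loop exceeds n rounds, which increase with n; an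
   execution that does not terminate has no outcome. *)
Definition law (T : Type) := nat -> cdist T.

Definition Pr T (d : law T) (E : pred (T * nat)) : \bar R :=
  ereal_sup (range (fun n => (prob (d n) E)%:E)).

Variables (X : finType) (Xi : choiceType).

(* An oracle algorithm: run a circuit on an oracle-independent initial state,
   measure all its registers, and continue as a function of the outcome. *)
CoInductive qprog (O : Type) :=
| Ret (o : O)
| Run (B : choiceType) (v : qstate R B) (c : circuit R X Xi B)
      (k : B -> qprog O).

Fixpoint run (Q : unitary R (regs R X Xi)) O (p : qprog O) (n : nat) :
    cdist O :=
  match p, n with
  | Ret o, _ => cret o
  | Run B v c k, n'.+1 =>
      let u := run_circuit Q c v in
      cbind [seq (abs2 (mcoeff b u), (b, queries c)) | b <- msupp u]
            (fun b => run Q (k b) n')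
  | Run _ _ _ _, 0%N => [::]
  end.

(* A quantum procedure; the registers X and F are read off the basis states of
   [pbasis] by [solution] and [flag]. *)
Record qproc := QProc {
  pbasis : choiceType;
  pinit : qstate R pbasis;
  pcirc : circuit R X Xi pbasis;
  solution : pbasis -> X;
  flag : pbasis -> bool }.

Section Output.
Variables (Q : unitary R (regs R X Xi)) (A : qproc).

Definition output_state : vec R (pbasis A) :=
  run_circuit Q (pcirc A) (pinit A).

Definition p_label : R := proj_sqnorm (@flag A) output_state.

(* law of the measurement of the register X in the normalized projection of
   the output state onto F = 1 *)
Definition flagged_law (x : X) : R :=
  proj_sqnorm [pred b | flag b && (solution b == x)] output_state / p_label.

End Output.

(* Coherent mean estimation: [qcirc] acts on the registers X and P, where P,
   holding the estimate and the workspace, starts in the basis state [qblank];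
   [qest] reads the estimate off a basis state of P. *)
Record qae_circuit := QAECircuit {
  qreg : choiceType;
  qblank : qreg;
  qest : qreg -> R;
  qcirc : circuit R X Xi (X * qreg)%type }.

End Programs.

Section Subroutines.
Variable R : realType.

(* arguments: blank state xi0, bound on the standard deviation, accuracy,
   risk *)
Definition qae_family := forall (X : finType) (Xi : choiceType),
  Xi -> R -> R -> R -> qae_circuit R X Xi.

(* arguments: procedure, risk *)
Definition amplify_family := forall (X : finType) (Xi : choiceType),
  qproc R X Xi -> R -> qprog R X Xi X.

(* arguments: procedure, relative accuracy, risk *)
Definition estimate_family := forall (X : finType) (Xi : choiceType),
  qproc R X Xi -> R -> R -> qprog R X Xi R.

(* The factors 1 + _ make the bounds O(sigma/eps * log(1/delta)) meaningful
   also where sigma/eps or log(1/delta) is close to 0. *)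
Definition qae_spec (C : R) (qae : qae_family) : Prop :=
  forall (X : finType) (Xi : choiceType) (xi0 : Xi) (sigma eps delta : R),
  0 <= sigma -> 0 < eps -> 0 < delta < 1 ->
  let c := qae X Xi xi0 sigma eps delta in
  (queries (qcirc c))%:R <= C * (1 + sigma / eps) * (1 + ln delta^-1) /\
  forall (I : problem R X Xi) (Q : unitary R (regs R X Xi)),
  simulation_oracle I xi0 Q -> (forall x, stddev I x <= sigma) ->
  forall x, exists psi : qstate R (qreg c),
    run_circuit Q (qcirc c) (ket (x, qblank c)) = tensor (ket x) psi /\
    1 - delta <= proj_sqnorm [pred p | `|qest p - mean I x| <= eps] psi.

(* Since p_label is unknown to the algorithm, the query bound, like the
   correctness of the prepared state, holds with probability at least
   1 - delta.  On that event the output follows the law [flagged_law]. *)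
Definition amplify_spec (C : R) (amplify : amplify_family) : Prop :=
  forall (X : finType) (Xi : choiceType) (A : qproc R X Xi) (delta : R)
    (Q : unitary R (regs R X Xi)),
  0 < delta < 1 -> 0 < p_label Q A ->
  let T := (queries (pcirc A))%:R in
  let bound := C * (T / Num.sqrt (p_label Q A)) * (1 + ln delta^-1) in
  forall x, let E := [pred r : X * nat | (r.1 == x) && (r.2%:R <= bound)] in
  (((1 - delta) * flagged_law Q A x)%:E <=
     Pr (run Q (amplify X Xi A delta)) E)%E.

Definition estimate_spec (C : R) (estimate : estimate_family) : Prop :=
  forall (X : finType) (Xi : choiceType) (A : qproc R X Xi) (eps delta : R)
    (Q : unitary R (regs R X Xi)),
  0 < eps < 1 -> 0 < delta < 1 -> 0 < p_label Q A ->
  let p := p_label Q A in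
  let T := (queries (pcirc A))%:R in
  let bound := C * (T / (eps * Num.sqrt p)) * (1 + ln delta^-1) in
  let E := [pred r : R * nat |
             (`|r.1 - p| <= eps * p) && (r.2%:R <= bound)] in
  ((1 - delta)%:E <= Pr (run Q (estimate X Xi A eps delta)) E)%E.

End Subroutines.

Section Thresholds.
Variable R : realType.
Implicit Types l eta : R.

Definition bits eta : int := Num.ceil (ln (2 * eta)^-1 / ln 2) + 2.

Definition lower l eta : R := l + eta - 2 ^ (1 - bits eta).

Definition upper l eta : R := l + eta - 2 ^ (- bits eta).

End Thresholds.

Section FlagOracle.
Variables (R : realType) (X : finType) (Xi : choiceType).
Variables (xi0 : Xi) (X_gt0 : (0 < #|X|)%N).

Section Registers.
Variable P : choiceType.

(* registers (X, xi, Y), P, A, F in this order *)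
Definition flag_basis : choiceType := (regs R X Xi * (P * (bool * bool)))%type.

Definition wire_oracle :
    wiring flag_basis (regs R X Xi * (P * (bool * bool))) :=
  @Wiring flag_basis (regs R X Xi * (P * (bool * bool))) id id
    (fun=> erefl) (fun=> erefl).

Definition wire_qae : wiring flag_basis ((X * P) * ((Xi * R) * (bool * bool))).
Proof.
by exists (fun '((x, d), (p, af)) => ((x, p), (d, af)))
          (fun '((x, p), (d, af)) => ((x, d), (p, af)));
  [case=> [[? ?] [? ?]] | case=> [[? ?] [? ?]]].
Defined.

Definition wire_compare : wiring flag_basis ((P * bool) * (regs R X Xi * bool)).
Proof.
by exists (fun '(r, (p, (a, f))) => ((p, a), (r, f)))
          (fun '((p, a), (r, f)) => (r, (p, (a, f))));
  [case=> [? [? [? ?]]] | case=> [[? ?] [? ?]]].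
Defined.

Definition wire_cnot : wiring flag_basis ((bool * bool) * (regs R X Xi * P)).
Proof.
by exists (fun '(r, (p, af)) => (af, (r, p)))
          (fun '(af, (r, p)) => (r, (p, af)));
  [case=> [? [? ?]] | case=> [? [? ?]]].
Defined.

Definition cnot (af : bool * bool) : bool * bool := (af.1, af.2 (+) af.1).

Lemma cnotK : involutive cnot.
Proof. by case=> -[] []. Qed.

Definition compare (est : P -> R) (lo hi : R) (pa : P * bool) : P * bool :=
  (pa.1, pa.2 (+) ((lo + hi) / 2 < est pa.1)).

Lemma compareK est lo hi : involutive (compare est lo hi).
Proof. by case=> p a; rewrite /compare /= -addbA addbb addbF. Qed.

Definition flag_start (p0 : P) (x : X) : flag_basis :=
  ((x, (xi0, 0)), (p0, (false, false))).

Lemma flag_start_inj p0 : injective (flag_start p0).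
Proof. by move=> x y []. Qed.

End Registers.

Variable qae : qae_family R.

(* QAE is run with the bound 1/2 on the standard deviation, valid for every
   [0,1]-valued random variable. *)
Definition flag_oracle (l eta kappa : R) : qproc R X Xi :=
  let alpha := kappa ^+ 2 / (4 * #|X|%:R ^+ 3) in
  let c := qae X xi0 (1 / 2) (2 ^ (- bits eta) / 3) alpha in
  let P := qreg c in
  @QProc R X Xi (flag_basis P)
    (uniform_state R X_gt0 (@flag_start_inj P (qblank c)))
    ([:: Query (wire_oracle P) false]
     ++ lift_circuit (wire_qae P) (qcirc c)
     ++ [:: Gate X Xi (wire_compare P)
              (perm_unitary R
                 (compareK (@qest _ _ _ c) (lower l eta) (upper l eta)));
            Gate X Xi (wire_cnot P) (perm_unitary R cnotK)])
    (fun b => b.1.1)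
    (fun b => b.2.2.2).

End FlagOracle.

Section SOGAS.
Variables (R : realType) (X : finType) (Xi : choiceType) (xi0 : Xi).
Variable X_gt0 : (0 < #|X|)%N.
Variable Q : unitary R (regs R X Xi).
Variable Qbar : unitary R (regs R (option X) Xi).
(* number of queries to Q needed for one query to Qbar *)
Variable cbar : nat.
Variables (qae : qae_family R) (amplify : amplify_family R).
Variable (estimate : estimate_family R).

Lemma card_option_gt0 : (0 < #|{: option X}|)%N.
Proof. by rewrite card_option. Qed.

Section OptimalRegion.
Variables (eps delta' : R).

(* the estimate r_t for R_t = [a, b] *)
Definition region_test (n t : nat) (a b : R) : cdist R R :=
  let eta := (b - a) / 4 in
  let l := (a + b) / 2 in
  let delta_t := delta' / 2 ^+ t.+1 in
  let A := flag_oracle xi0 card_option_gt0 qae l eta (delta_t / 10) in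
  charge cbar (run Qbar (estimate A (1 / 10) delta_t) n).

Definition region_next (a b r : R) : R * R :=
  let eta := (b - a) / 4 in
  let l := (a + b) / 2 in
  if 3 / (2 * (#|X|%:R + 1)) < r then (lower l eta, b) else (a, upper l eta).

(* at most k iterations of the loop, started at step t with R_t = [a, b] *)
Fixpoint region_loop (n k t : nat) (a b : R) : cdist R (R * R) :=
  if eps / 2 <= b - a then
    if k is k'.+1 then
      cbind (region_test n t a b)
        (fun r => let: (a', b') := region_next a b r in
                  region_loop n k' t.+1 a' b')
    else [::]
  else cret R (a, b).

Definition optimal_region : law R (R * R) :=
  fun n => region_loop n n 0 0 1.

End OptimalRegion.

Definition sogas (eps delta : R) : law R X := fun n =>
  cbind (optimal_region eps (delta / 2) n)
    (fun '(a, b) =>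
       let eta := (b - a) / 4 in
       let l := a - 3 / 4 * eta in
       let A_flag := flag_oracle xi0 X_gt0 qae l eta (delta / 100) in
       run Q (amplify A_flag (delta / 2)) n).

End SOGAS.

(* Main.v *)
Require Import Defs.
From HB Require Import structures.
From mathcomp Require Import all_boot all_order all_algebra.
From mathcomp Require Import complex finmap.
From mathcomp Require Import -(notations) monalg.
From mathcomp Require Import classical_sets reals ereal exp.
From mathcomp Require Import ring lra.

(* Flagging.  On input x the flag is raised with a probability q x that is at
   least 1 - alpha if y(x) >= upper and at most alpha if y(x) <= lower, because
   the accuracy 2^-m / 3 is smaller than half the width 2^-m of [lower, upper].
   Hence p_label is the average of q, and up to O(alpha) it counts the solutions
   above the threshold.

   Search.  The auxiliary solution is always flagged, so p_label >= 1 / (4 |X|),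
   which is where the square root comes from.  If y(xstar) > upper, two solutions
   are flagged and p_label is about 2 / (|X| + 1) or more; if y(xstar) < lower,
   only one is and p_label is about 1 / (|X| + 1).  The cutoff 3 / (2 (|X| + 1))
   separates the two cases, and in between either update keeps y(xstar) in the
   region.  Every round removes at least 5/16 of the region, so the number of
   rounds depends on eps only.

   Output.  The last threshold lies just below the region, so xstar is flagged,
   whereas a solution that is not eps-optimal has y(x) <= lower and contributes
   at most alpha.

   Probabilities.  A run with unbounded loops is a supremum over the fuel n, so
   a lower bound on it is used up to an arbitrary e > 0, for n large enough.
   The resulting losses are absorbed by the slack in (1 - x)^2 >= 1 - 2 x. *)

Set Implicit Arguments.
Unset Strict Implicit.
Unset Printing Implicit Defensive.

Import Order.TTheory GRing.Theory Num.Theory.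
Local Open Scope ring_scope.

(** * Linear maps given by their values on basis states *)

Section LinearExtensions.
Variable R : realType.
Implicit Types B W : choiceType.

HB.instance Definition _ B B' (f : B -> vec R B') :=
  GRing.isLinear.Build R[i] (vec R B) (vec R B') *:%R (lin_ext f)
    (lin_ext_linear f).

Lemma lin_ext_ket B B' (f : B -> vec R B') b : lin_ext f (ket b) = f b.
Proof.
by rewrite /lin_ext /ket msuppU oner_eq0 big_seq_fset1 mcoeffUU scale1r.
Qed.

Lemma vecE B (v : vec R B) : v = \sum_(b <- msupp v) mcoeff b v *: ket b.
Proof.
apply/malgP => k; rewrite raddf_sum /=.
under eq_bigr do rewrite mcoeffZ mcoeffU.
have [kv|kv] := boolP (k \in msupp v).
  rewrite (big_fsetD1 k) //= eqxx mulr1 big1_seq ?addr0 // => b.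
  by rewrite andTb !inE => /andP[/negPf-> _]; rewrite mulr0.
rewrite (mcoeff_outdom kv) big1_seq // => b /andP[_ bv].
case: eqP => [e|_]; last by rewrite mulr0.
by rewrite -e bv in kv.
Qed.

(** Circuits come as bare functions with a proof of linearity; in this form they can be evaluated on
    one basis state at a time. *)
Lemma linear_lin_ext B B' (U : vec R B -> vec R B') : linear U ->
  U =1 lin_ext (fun b => U (ket b)).
Proof.
move=> U_lin v.
pose L := GRing.isLinear.Build R[i] (vec R B) (vec R B') *:%R U U_lin.
pose U' : {linear vec R B -> vec R B'} := HB.pack U L.
rewrite {1}[v]vecE -[U]/(U' : _ -> _) linear_sum.
by apply: eq_bigr => b _; rewrite linearZ.
Qed.

Lemma lin_ext_comp B B' B'' (g : B' -> vec R B'') (f : B -> vec R B') v :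
  lin_ext g (lin_ext f v) = lin_ext (fun b => lin_ext g (f b)) v.
Proof.
rewrite {2}/lin_ext linear_sum.
by apply: eq_bigr => b _; rewrite linearZ.
Qed.

Lemma eq_lin_ext B B' (f g : B -> vec R B') : f =1 g -> lin_ext f =1 lin_ext g.
Proof. by move=> fg v; apply: eq_bigr => b _; rewrite fg. Qed.

Lemma relabel_ket B B' (f : B -> B') b : relabel f (ket b : vec R B) = ket (f b).
Proof. exact: lin_ext_ket. Qed.

Lemma lin_ext_relabel B B' B'' (g : B' -> vec R B'') (f : B -> B') v :
  lin_ext g (relabel f v) = lin_ext (fun b => g (f b)) v.
Proof. by rewrite lin_ext_comp; apply: eq_lin_ext => b; rewrite lin_ext_ket. Qed.

Lemma relabel_comp B B' B'' (g : B' -> B'') (f : B -> B') (v : vec R B) :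
  relabel g (relabel f v) = relabel (fun b => g (f b)) v.
Proof. exact: lin_ext_relabel. Qed.

Lemma tensor_ketl B1 B2 (b : B1) (v : vec R B2) :
  tensor (ket b) v = relabel (pair b) v.
Proof. exact: lin_ext_ket. Qed.

Lemma tensor_ketr B1 B2 (u : vec R B1) (b : B2) :
  tensor u (ket b) = relabel (fun b1 => (b1, b)) u.
Proof. by apply: eq_lin_ext => b1; rewrite lin_ext_ket. Qed.

(** The spectator factor stays in a basis state, so tensoring with it is a mere relabelling. *)
Lemma apply_onE B B1 W (w : wiring B (B1 * W)) (U : vec R B1 -> vec R B1) v :
  apply_on w U v =
  lin_ext (fun b => relabel (fun b1 => unwire w (b1, (wire w b).2))
                      (U (ket (wire w b).1))) v.
Proof. by apply: eq_lin_ext => b; rewrite tensor_ketr relabel_comp. Qed.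

Lemma apply_on_ket B B1 W (w : wiring B (B1 * W)) (U : vec R B1 -> vec R B1) b :
  apply_on w U (ket b) =
  relabel (fun b1 => unwire w (b1, (wire w b).2)) (U (ket (wire w b).1)).
Proof. by rewrite apply_onE lin_ext_ket. Qed.

Lemma apply_on_perm_ket B B1 W (w : wiring B (B1 * W)) (f : B1 -> B1)
    (fK : involutive f) b :
  apply_on w (perm_unitary R fK) (ket b) =
  ket (unwire w (f (wire w b).1, (wire w b).2)).
Proof. by rewrite apply_on_ket /= lin_ext_ket relabel_ket. Qed.

End LinearExtensions.

(** * Semantics of circuits and of the oracle *)

Section CircuitRuns.
Variables (R : realType) (X : finType) (Xi : choiceType).
Variable Q : unitary R (regs R X Xi).
Implicit Types B W : choiceType.

Lemma run_step_linear B (s : step R X Xi B) :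
  linear (fun v => run_step Q v s).
Proof. by case: s => [B1 W w U|W w inv]; apply: lin_ext_linear. Qed.

Lemma run_circuit_cons B (s : step R X Xi B) (c : circuit R X Xi B) v :
  run_circuit Q (s :: c) v = run_circuit Q c (run_step Q v s).
Proof. by []. Qed.

Lemma run_circuit_linear B (c : circuit R X Xi B) : linear (run_circuit Q c).
Proof.
move=> k u v; elim: c u v => [//|s c IH] u v.
by rewrite !run_circuit_cons run_step_linear IH.
Qed.

Lemma run_circuit_lin_ext B B' (c : circuit R X Xi B) (f : B' -> vec R B) v :
  run_circuit Q c (lin_ext f v) = lin_ext (fun b => run_circuit Q c (f b)) v.
Proof.
rewrite (linear_lin_ext (run_circuit_linear c)) lin_ext_comp.
by apply: eq_lin_ext => b; rewrite -(linear_lin_ext (run_circuit_linear c)).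
Qed.

Lemma run_circuit_cat B (c1 c2 : circuit R X Xi B) v :
  run_circuit Q (c1 ++ c2) v = run_circuit Q c2 (run_circuit Q c1 v).
Proof. exact: foldl_cat. Qed.

(** No step of the lifted circuit acts on the spectator label [k], so the label is carried through
    one step at a time. *)
Lemma run_lift_circuit B B1 W (w : wiring B (B1 * W)) (c : circuit R X Xi B1)
    (u : vec R B1) (k : W) :
  run_circuit Q (lift_circuit w c) (relabel (fun b => unwire w (b, k)) u) =
  relabel (fun b => unwire w (b, k)) (run_circuit Q c u).
Proof.
have lift_apply B2 W2 (w2 : wiring B1 (B2 * W2)) (U : vec R B2 -> vec R B2) u' :
    apply_on (wcomp w w2) U (relabel (fun b => unwire w (b, k)) u') =
    relabel (fun b => unwire w (b, k)) (apply_on w2 U u').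
  rewrite !apply_onE lin_ext_relabel {2}/relabel lin_ext_comp.
  apply: eq_lin_ext => b; rewrite -/(relabel _ _) relabel_comp /=.
  by rewrite /wcomp_wire unwireK.
elim: c u => [//|s c IH] u; rewrite [lift_circuit _ _]/= !run_circuit_cons -IH.
by congr (run_circuit _ _ _); case: s => *; apply: lift_apply.
Qed.

Lemma queries_lift B B1 W (w : wiring B (B1 * W)) (c : circuit R X Xi B1) :
  queries (lift_circuit w c) = queries c.
Proof. by rewrite /queries count_map; apply: eq_count => -[]. Qed.

(** The oracle is specified on superpositions of unit norm; amplitudes concentrated at [x] isolate a
    single solution. *)
Lemma oracle_ket (I : problem R X Xi) xi0 x : simulation_oracle I xi0 Q ->
  Q (ket (x, (xi0, 0))) = relabel (pair x) (data I x).
Proof.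
have sumE B (f : X -> vec R B) : \sum_y (y == x)%:R *: f y = f x.
  rewrite (bigD1 x) //= eqxx scale1r big1 ?addr0 // => y /negPf->.
  by rewrite scale0r.
have norm1 : \sum_y abs2 ((y == x)%:R : R[i]) = 1.
  rewrite (bigD1 x) //= eqxx big1 => [|y /negPf->].
    by rewrite /abs2 /= expr1n expr0n !addr0.
  by rewrite /abs2 /= expr0n addr0.
move=> /(_ _ norm1) QE; rewrite -tensor_ketl.
apply: etrans (etrans QE (sumE _ (fun y => tensor (ket y) (data I y)))).
by congr (Q _); apply: esym; apply: (sumE _ (fun y => ket (y, (xi0, 0)))).
Qed.

End CircuitRuns.

(** * Squared norms of projections onto basis states *)

Section ProjectionNorms.
Variable R : realType.
Implicit Types B : choiceType.

Lemma abs2_ge0 (z : R[i]) : 0 <= abs2 z.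
Proof. by rewrite addr_ge0 ?sqr_ge0. Qed.

Lemma abs20 : abs2 (0 : R[i]) = 0.
Proof. by rewrite /abs2 /= expr0n addr0. Qed.

Lemma abs2_eq0 (z : R[i]) : (abs2 z == 0) = (z == 0).
Proof.
case: z => a b; rewrite /abs2 eq_complex /=.
by rewrite paddr_eq0 ?sqr_ge0 // !sqrf_eq0.
Qed.

Lemma abs2M (z w : R[i]) : abs2 (z * w) = abs2 z * abs2 w.
Proof. by case: z w => [a b] [c d]; rewrite /abs2 /=; ring. Qed.

Lemma proj_sqnormEw B (p : pred B) (v : vec R B) (d : {fset B}) :
  (msupp v `<=` d)%fset ->
  proj_sqnorm p v = \sum_(b <- d) (p b)%:R * abs2 (mcoeff b v).
Proof.
move=> sub; rewrite /proj_sqnorm big_mkcond /=.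
rewrite (eq_bigr (fun b => (p b)%:R * abs2 (mcoeff b v))); last first.
  by move=> b _; case: (p b); rewrite ?mul1r ?mul0r.
apply: big_fset_incl => // b _ bv.
by rewrite (mcoeff_outdom bv) abs20 mulr0.
Qed.

Lemma proj_sqnormE B (p : pred B) (v : vec R B) :
  proj_sqnorm p v = \sum_(b <- msupp v) (p b)%:R * abs2 (mcoeff b v).
Proof. exact: proj_sqnormEw. Qed.

Lemma proj_sqnorm_ket B (p : pred B) (b : B) :
  proj_sqnorm p (ket b : vec R B) = (p b)%:R.
Proof.
rewrite proj_sqnormE /ket msuppU oner_eq0 big_seq_fset1 mcoeffUU.
by rewrite /abs2 /= expr1n expr0n addr0 mulr1.
Qed.

Lemma proj_sqnormT B (v : vec R B) : proj_sqnorm predT v = sqnorm v.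
Proof. by []. Qed.

Lemma proj_sqnorm_ge0 B (p : pred B) (v : vec R B) : 0 <= proj_sqnorm p v.
Proof. by apply: sumr_ge0 => b _; apply: abs2_ge0. Qed.

Lemma proj_sqnormC B (p : pred B) (v : vec R B) :
  proj_sqnorm p v + proj_sqnorm [pred b | ~~ p b] v = sqnorm v.
Proof. by rewrite /sqnorm (bigID p). Qed.

Lemma le_proj_sqnorm B (p q : pred B) (v : vec R B) :
  (forall b, p b -> q b) -> proj_sqnorm p v <= proj_sqnorm q v.
Proof.
move=> pq; rewrite !proj_sqnormE; apply: ler_sum => b _.
rewrite ler_wpM2r ?abs2_ge0 // ler_nat.
by case: (p b) (pq b) => // ->.
Qed.

(** Only the term indexed by [lab e] can contribute at [e]: there is no interference. *)
Lemma mcoeff_lin_ext B B' (f : B -> vec R B') (lab : B' -> B) v e :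
  (forall b e, mcoeff e (f b) != 0 -> lab e = b) ->
  mcoeff e (lin_ext f v) = mcoeff (lab e) v * mcoeff e (f (lab e)).
Proof.
move=> labP; rewrite raddf_sum /=; under eq_bigr do rewrite mcoeffZ.
have f0 b : b != lab e -> mcoeff e (f b) = 0.
  by apply: contraNeq => /labP ->.
have [ev|ev] := boolP (lab e \in msupp v).
  rewrite (big_fsetD1 (lab e)) //= big1_seq ?addr0 // => b.
  by rewrite andTb !inE => /andP[/f0-> _]; rewrite mulr0.
rewrite (mcoeff_outdom ev) mul0r big1_seq // => b /andP[_ bv].
by rewrite f0 ?mulr0 //; apply: contraNneq ev => <-.
Qed.

(* The label makes the supports of the f b pairwise disjoint, so that the
   f b are orthogonal even after a projection onto basis states. *)
Lemma proj_sqnorm_lin_ext B B' (f : B -> vec R B') (lab : B' -> B)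
    (p : pred B') v :
  (forall b e, mcoeff e (f b) != 0 -> lab e = b) ->
  proj_sqnorm p (lin_ext f v) =
  \sum_(b <- msupp v) abs2 (mcoeff b v) * proj_sqnorm p (f b).
Proof.
move=> labP; set D := msupp (lin_ext f v).
have suppf b : b \in msupp v -> (msupp (f b) `<=` D)%fset.
  move=> bv; apply/fsubsetP => e; rewrite -mcoeff_neq0 => fe0.
  rewrite -mcoeff_neq0 (mcoeff_lin_ext v e labP) (labP _ _ fe0).
  by rewrite mulf_neq0 // mcoeff_neq0.
rewrite proj_sqnormE -/D; under eq_bigr do rewrite (mcoeff_lin_ext _ _ labP).
transitivity (\sum_(b <- msupp v) \sum_(e <- D)
    abs2 (mcoeff b v) * ((p e)%:R * abs2 (mcoeff e (f b)))); last first.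
  rewrite big_seq [RHS]big_seq; apply: eq_bigr => b bv.
  by rewrite (proj_sqnormEw _ (suppf _ bv)) mulr_sumr.
rewrite exchange_big /= big_seq [RHS]big_seq; apply: eq_bigr => e eD.
have ev : lab e \in msupp v.
  move: eD; rewrite -!mcoeff_neq0 (mcoeff_lin_ext v e labP) mulf_eq0.
  by rewrite negb_or => /andP[].
rewrite (big_fsetD1 (lab e)) //= big1_seq ?addr0 => [|b].
  by rewrite abs2M mulrCA.
rewrite andTb !inE => /andP[b_e _].
have [->|/labP eb] := eqVneq (mcoeff e (f b)) 0; first by rewrite abs20 !mulr0.
by rewrite eb eqxx in b_e.
Qed.

Lemma mcoeff_relabel_neq0 B B' (f : B -> B') (v : vec R B) e :
  mcoeff e (relabel f v) != 0 -> exists b, e = f b.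
Proof.
have [/hasP[b _ /eqP<-]|/hasPn fe] := boolP (has (fun b => f b == e) (msupp v)).
  by exists b.
rewrite raddf_sum /= big1_seq ?eqxx // => b /andP[_ /fe/negPf fbe].
by rewrite mcoeffZ mcoeffU fbe mulr0.
Qed.

Lemma proj_sqnorm_relabel B B' (f : B -> B') (lab : B' -> B) (p : pred B')
    (v : vec R B) :
  cancel f lab -> proj_sqnorm p (relabel f v) = proj_sqnorm (p \o f) v.
Proof.
move=> fK; rewrite (@proj_sqnorm_lin_ext _ _ _ lab) => [|b e].
  by rewrite proj_sqnormE; apply: eq_bigr => b _; rewrite proj_sqnorm_ket mulrC.
by rewrite mcoeffU; case: (f b =P e) => [<-|_]; rewrite ?fK ?eqxx.
Qed.

(** The output is a function of the input [xi], so the state is the amplitude vector [a] relabelled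
    along an injective graph map; equal outputs of distinct inputs do not interfere. *)
Lemma sqnorm_data (X : finType) (Xi : choiceType) (I : problem R X Xi) x :
  sqnorm (data I x) = 1.
Proof.
pose a : vec R Xi := \sum_(xi <- msupp (pmf I x))
  (Num.sqrt (mcoeff xi (pmf I x)))%:C%C *: ket xi.
have aE xi : abs2 (mcoeff xi a) = mcoeff xi (pmf I x).
  rewrite raddf_sum /=; under eq_bigr do rewrite mcoeffZ mcoeffU.
  have [xiI|xiI] := boolP (xi \in msupp (pmf I x)).
    rewrite (big_fsetD1 xi) //= eqxx mulr1 big1_seq ?addr0 => [|xi'].
      by rewrite /abs2 /= expr0n addr0 sqr_sqrtr // pmf_ge0.
    by rewrite andTb !inE => /andP[/negPf-> _]; rewrite mulr0.
  rewrite (mcoeff_outdom xiI) big1_seq ?abs20 // => xi' /andP[_ xi'I].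
  case: eqP => [e|_]; last by rewrite mulr0.
  by rewrite -e xi'I in xiI.
have -> : data I x = relabel (fun xi => (xi, Yfun I x xi)) a.
  rewrite /relabel linear_sum; apply: eq_bigr => xi _.
  by rewrite linearZ /= lin_ext_ket.
rewrite -proj_sqnormT (@proj_sqnorm_relabel _ _ _ fst) //.
rewrite (@proj_sqnormEw _ _ _ (msupp (pmf I x))).
  by rewrite -[RHS](pmf_sum1 I x); apply: eq_bigr => xi _; rewrite mul1r aE.
apply/fsubsetP => xi; rewrite -!mcoeff_neq0 -[mcoeff xi (pmf I x)]aE.
by rewrite abs2_eq0.
Qed.

Lemma proj_sqnorm_uniform (X : finType) B (f : X -> vec R B) (lab : B -> X)
    (p : pred B) :
  (0 < #|X|)%N -> (forall x e, mcoeff e (f x) != 0 -> lab e = x) ->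
  proj_sqnorm p (lin_ext f (uniform_vec R id)) =
  (\sum_x proj_sqnorm p (f x)) / #|X|%:R.
Proof.
move=> X0 labP; rewrite (proj_sqnorm_lin_ext _ _ labP).
have -> : msupp (uniform_vec R id) = [fset x | x in X]%fset.
  apply/fsetP => x; rewrite -mcoeff_neq0 (mcoeff_uniform _ (@inj_id X)).
  rewrite !inE.
  by rewrite -abs2_eq0 /abs2 /= expr0n addr0 sqrf_eq0 invr_eq0 sqrtr_eq0
             -ltNge ltr0n.
rewrite big_imfset //= big_enum mulr_suml; apply: eq_bigr => x _.
rewrite (mcoeff_uniform _ (@inj_id X)) mulrC; congr (_ * _).
by rewrite /abs2 /= expr0n addr0 exprVn sqr_sqrtr ?ler0n.
Qed.

End ProjectionNorms.

(** * The output state of the flag oracle *)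

Section FlagOracleState.
Variables (R : realType) (X : finType) (Xi : choiceType) (xi0 : Xi).
Variable X_gt0 : (0 < #|X|)%N.
Variables (qae : qae_family R) (l eta kappa : R).

Let alpha : R := kappa ^+ 2 / (4 * #|X|%:R ^+ 3).
Let c := qae X xi0 (1 / 2) (2 ^ (- bits eta) / 3) alpha.
Let A := flag_oracle xi0 X_gt0 qae l eta kappa.
Let above (e : R) := (lower l eta + upper l eta) / 2 < e.

Lemma queries_flag_oracle : queries (pcirc A) = (queries (qcirc c)).+1.
Proof.
rewrite /A /flag_oracle /= /queries /= count_cat /= !addn0.
by rewrite -[count _ (lift_circuit _ _)]/(queries _) queries_lift.
Qed.

(** The registers [A] and [F] start at 0, so the comparison and the CNOT leave the same bit in both.
    For fixed [x] the state [psi x] does not depend on the data [d]. *)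
Lemma flag_oracle_run (I : problem R X Xi) (Q : unitary R (regs R X Xi))
    (psi : X -> vec R (qreg c)) :
  simulation_oracle I xi0 Q ->
  (forall x, run_circuit Q (qcirc c) (ket (x, qblank c)) =
             tensor (ket x) (psi x)) ->
  output_state Q A =
  lin_ext (fun x => lin_ext (fun d => relabel (fun p : qreg c =>
      ((x, d), (p, (above (qest p), above (qest p))))) (psi x))
    (data I x)) (uniform_vec R id).
Proof.
move=> QP psiP; rewrite /output_state.
have -> : pinit A = lin_ext (fun x => ket (flag_start R xi0 (qblank c) x))
                      (uniform_vec R id) :> vec R _.
  rewrite /= /uniform_vec linear_sum; apply: eq_bigr => x _.
  by rewrite linearZ /= lin_ext_ket.
rewrite run_circuit_lin_ext; apply: eq_lin_ext => x.
rewrite [pcirc A]/= run_circuit_cons [run_step _ _ _]/= apply_on_ket /=.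
rewrite (oracle_ket x QP) relabel_comp run_circuit_cat /relabel.
rewrite !run_circuit_lin_ext; apply: eq_lin_ext => d.
have -> : ket (x, d, (qblank c, (false, false))) = relabel
    (fun b => unwire (wire_qae R X Xi (qreg c)) (b, (d, (false, false))))
    (ket (x, qblank c)) :> vec R (flag_basis R X Xi (qreg c)).
  by rewrite relabel_ket.
rewrite run_lift_circuit psiP tensor_ketl relabel_comp.
rewrite /relabel run_circuit_lin_ext; apply: eq_lin_ext => p.
have compareE := apply_on_perm_ket R (wire_compare R X Xi (qreg c))
  (compareK (@qest _ _ _ c) (lower l eta) (upper l eta))
  ((x, d), (p, (false, false))).
have cnotE := apply_on_perm_ket R (wire_cnot R X Xi (qreg c)) cnotK
  ((x, d), (p, (above (qest p), false))).
rewrite -[LHS]/(apply_on _ _ (apply_on _ _ (ket _))).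
exact: etrans (congr1 _ compareE) cnotE.
Qed.

(** The nested superpositions are peeled off by reading first [x], then [d], then the register [P]
    from a basis state. The flag ignores [d], so the data contribute only their norm 1. *)
Lemma flag_oracle_proj (I : problem R X Xi) (Q : unitary R (regs R X Xi))
    (psi : X -> vec R (qreg c)) (g : pred X) :
  simulation_oracle I xi0 Q ->
  (forall x, run_circuit Q (qcirc c) (ket (x, qblank c)) =
             tensor (ket x) (psi x)) ->
  proj_sqnorm [pred b | flag b && g (solution b)] (output_state Q A) =
  (\sum_(x | g x) proj_sqnorm [pred p | above (qest p)] (psi x)) / #|X|%:R.
Proof.
move=> QP psiP; rewrite (flag_oracle_run QP psiP).
pose h x d (p : qreg c) : pbasis A :=
  ((x, d), (p, (above (qest p), above (qest p)))).
have labd x d b : mcoeff b (relabel (h x d) (psi x)) != 0 -> b.1 = (x, d).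
  by move=> /mcoeff_relabel_neq0[p ->].
have labx x b : mcoeff b (lin_ext (fun d => relabel (h x d) (psi x))
    (data I x)) != 0 -> b.1.1 = x.
  rewrite (@mcoeff_lin_ext _ _ _ _ (fun b => b.1.2)) => [|d e /labd->] //.
  by rewrite mulf_eq0 negb_or => /andP[_ /labd ->].
rewrite (@proj_sqnorm_uniform _ _ _ _ (fun b => b.1.1)) //.
congr (_ / _); rewrite [RHS]big_mkcond; apply: eq_bigr => x _.
rewrite (@proj_sqnorm_lin_ext _ _ _ _ (fun b => b.1.2)) => [|d e /labd->] //.
transitivity (\sum_(d <- msupp (data I x)) abs2 (mcoeff d (data I x)) *
    (if g x then proj_sqnorm [pred p | above (qest p)] (psi x) else 0)).
  apply: eq_bigr => d _; congr (_ * _).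
  rewrite (@proj_sqnorm_relabel _ _ _ _ (fun b => b.2.1)) //.
  case: ifP => gx; rewrite !proj_sqnormE.
    by apply: eq_bigr => p _; rewrite /= gx andbT.
  by apply: big1 => p _; rewrite /= gx andbF mul0r.
by rewrite -mulr_suml -/(sqnorm (data I x)) sqnorm_data mul1r.
Qed.

End FlagOracleState.

(** * Flagging probabilities and the cost of one flag oracle *)

Section FlagProbabilities.
Variable R : realType.

(** With [v] the base-2 logarithm of [(2 * eta)^-1], the ceiling puts [bits eta] between [v + 2] and
    [v + 3], the latter excluded; these exponents give [eta / 2] and [eta / 4]. The comparison is
    made on logarithms. *)
Lemma bits_bounds (eta : R) : 0 < eta ->
  eta / 4 < 2 ^ (- bits eta) :> R /\ 2 ^ (- bits eta) <= eta / 2.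
Proof.
move=> eta0; have ln2 : 0 < ln 2 :> R by rewrite ln_gt0 ?ltr1n.
have h0 : 0 < 2 ^ (- bits eta) :> R by rewrite exprz_gt0.
have lnh : ln (2 ^ (- bits eta) : R) = - (bits eta)%:~R * ln 2.
  by rewrite -powR_intmul // ln_powR intrN.
have lnd n : ln (eta / (2 ^+ n)) = ln (2 * eta) - n.+1%:R * ln 2.
  rewrite ln_div ?posrE ?exprn_gt0 // lnM ?posrE // lnXn // -mulr_natl.
  by rewrite -addn1 natrD; ring.
have lnI : ln (2 * eta)^-1 = - ln (2 * eta).
  by rewrite lnV // posrE mulr_gt0.
set v := ln (2 * eta)^-1 / ln 2.
have vE : v * ln 2 = - ln (2 * eta) by rewrite -lnI mulfVK ?gt_eqF.
have /andP[] := ceil_itv v; rewrite /bits -/v in h0 lnh *.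
move: lnh; rewrite [(Num.ceil v + 2)%:~R]intrD intrB.
set k := (Num.ceil v)%:~R => lnh; set h := 2 ^ _ in h0 lnh * => k1 k2.
rewrite -ltr_ln ?posrE ?divr_gt0 // -ler_ln ?posrE ?divr_gt0 // lnh.
have := lnd 1%N; have := lnd 2%N; rewrite expr1 -natrX => -> ->.
split; first by rewrite -subr_gt0; nra.
by rewrite -subr_ge0; nra.
Qed.

Lemma upperE (l eta : R) : upper l eta = l + eta - 2 ^ (- bits eta).
Proof. by []. Qed.

Lemma lowerE (l eta : R) : lower l eta = l + eta - 2 * 2 ^ (- bits eta).
Proof. by rewrite /lower expfzDr // expr1z. Qed.

Lemma mean01 (X : finType) (Xi : choiceType) (I : problem R X Xi) x :
  (forall xi, xi \in msupp (pmf I x) -> 0 <= Yfun I x xi <= 1) ->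
  0 <= mean I x <= 1.
Proof.
move=> Y01; rewrite /mean; apply/andP; split.
  rewrite big_seq; apply: sumr_ge0 => xi /Y01/andP[Y0 _].
  by rewrite mulr_ge0 ?pmf_ge0.
rewrite -(pmf_sum1 I x) big_seq [leRHS]big_seq; apply: ler_sum => xi /Y01.
by case/andP=> _ Y1; rewrite ler_piMr ?pmf_ge0.
Qed.

(** Since [y ^ 2 <= y] on the unit interval, the variance is at most [mu - mu ^ 2], which is 1/4
    minus a square. *)
Lemma stddev_le_half (X : finType) (Xi : choiceType) (I : problem R X Xi) x :
  (forall xi, xi \in msupp (pmf I x) -> 0 <= Yfun I x xi <= 1) ->
  stddev I x <= 1 / 2.
Proof.
move=> Y01; set mu := mean I x.
have -> : 1 / 2 = Num.sqrt ((1 / 2) ^+ 2) :> R.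
  by rewrite sqrtr_sqr ger0_norm // divr_ge0.
rewrite /stddev ler_sqrt; last by rewrite exprn_ge0 // divr_ge0.
apply: (@le_trans _ _ (\sum_(xi <- msupp (pmf I x))
   ((1 - 2 * mu) * (mcoeff xi (pmf I x) * Yfun I x xi)
     + mu ^+ 2 * mcoeff xi (pmf I x)))).
  rewrite big_seq [leRHS]big_seq; apply: ler_sum => xi /Y01/andP[Y0 Y1].
  have := pmf_ge0 I x xi; rewrite -/mu; set p := mcoeff _ _; set y := Yfun _ _ _.
  move=> p0; have : 0 <= p * (y * (1 - y)).
    by rewrite !mulr_ge0 // subr_ge0.
  by rewrite -subr_ge0 => H; rewrite -subr_ge0; apply: le_trans H _; lra.
rewrite big_split /= -!mulr_sumr pmf_sum1 -/(mean I x) -/mu -subr_ge0.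
by apply: le_trans (sqr_ge0 (mu - 1 / 2)) _; lra.
Qed.

(** The second bound controls the flags wrongly raised by all [N] solutions together. *)
Lemma qae_risk_bounds (N kappa : R) : 1 <= N -> 0 < kappa < 1 ->
  [/\ 0 < kappa ^+ 2 / (4 * N ^+ 3) < 1,
      N * (kappa ^+ 2 / (4 * N ^+ 3)) <= kappa ^+ 2 / 4
    & kappa ^+ 2 / (4 * N ^+ 3) <= kappa ^+ 2 / 4].
Proof.
move=> N1 /andP[k0 k1]; have N0 : 0 < N by apply: lt_le_trans N1.
have k20 : 0 < kappa ^+ 2 / 4 by rewrite divr_gt0 ?exprn_gt0.
have aE : kappa ^+ 2 / (4 * N ^+ 3) = kappa ^+ 2 / 4 / N ^+ 3.
  by field; rewrite gt_eqF.
have NaE : N * (kappa ^+ 2 / (4 * N ^+ 3)) = kappa ^+ 2 / 4 / N ^+ 2.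
  by field; rewrite gt_eqF.
have a_le : kappa ^+ 2 / 4 / N ^+ 3 <= kappa ^+ 2 / 4.
  by rewrite ler_pdivrMr ?exprn_gt0 // ler_peMr ?exprn_ege1 // ltW.
rewrite NaE aE; split=> //.
  by rewrite divr_gt0 ?exprn_gt0 //; apply: le_lt_trans a_le _; nra.
by rewrite ler_pdivrMr ?exprn_gt0 // ler_peMr ?exprn_ege1 // ltW.
Qed.

Lemma ln_qae_risk (N kappa : R) : 1 <= N -> 0 < kappa < 1 ->
  1 + ln (kappa ^+ 2 / (4 * N ^+ 3))^-1 <= 4 + 3 * ln N + 2 * ln kappa^-1.
Proof.
move=> N1 /andP[k0 k1]; have N0 : 0 < N by apply: lt_le_trans N1.
have -> : (kappa ^+ 2 / (4 * N ^+ 3))^-1 = 4 * N ^+ 3 * kappa^-1 ^+ 2.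
  by field; rewrite !gt_eqF.
have ln4 : ln 4 <= 3 :> R.
  by have -> : 4 = 1 + 3 :> R by [ring]; apply: le_ln1Dx; lra.
rewrite lnM ?posrE ?mulr_gt0 ?exprn_gt0 ?invr_gt0 //.
rewrite [ln (4 * _)]lnM ?posrE ?exprn_gt0 //.
rewrite !lnXn ?invr_gt0 //; move: ln4; rewrite -[_ *+ 3]mulr_natl.
by rewrite -[_ *+ 2]mulr_natl; lra.
Qed.

Lemma qae_accuracy_bounds (eta : R) : 0 < eta ->
  0 <= (1 / 2 : R) / (2 ^ (- bits eta) / 3) <= 6 / eta.
Proof.
move=> eta0; have h0 : 0 < 2 ^ (- bits eta) :> R by rewrite exprz_gt0.
have [] := bits_bounds eta0; move: (2 ^ _) h0 => h h0 h1 _.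
apply/andP; split; first by rewrite !divr_ge0 // ltW.
rewrite ler_pdivrMr ?divr_gt0 // mulrAC ler_pdivlMr //.
by clear -h1 => /=; lra.
Qed.

Lemma flag_margin_above (l eta mu e : R) : upper l eta <= mu ->
  `|e - mu| <= 2 ^ (- bits eta) / 3 -> (lower l eta + upper l eta) / 2 < e.
Proof.
have h0 : 0 < 2 ^ (- bits eta) :> R by rewrite exprz_gt0.
rewrite lowerE upperE ler_norml; move: (2 ^ _) h0 => h h0 mx /andP[+ _].
by clear -h0 mx; lra.
Qed.

Lemma flag_margin_below (l eta mu e : R) : mu <= lower l eta ->
  `|e - mu| <= 2 ^ (- bits eta) / 3 -> ~~ ((lower l eta + upper l eta) / 2 < e).
Proof.
have h0 : 0 < 2 ^ (- bits eta) :> R by rewrite exprz_gt0.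
rewrite lowerE upperE ler_norml -leNgt.
move: (2 ^ _) h0 => h h0 mx /andP[_ +].
by clear -h0 mx; lra.
Qed.

Variables (X : finType) (Xi : choiceType) (xi0 : Xi) (X_gt0 : (0 < #|X|)%N).
Variables (qae : qae_family R) (Cqae : R) (qaeP : qae_spec Cqae qae).
Variables (l eta kappa : R).
Hypotheses (eta_gt0 : 0 < eta) (kappa01 : 0 < kappa < 1).

Let alpha : R := kappa ^+ 2 / (4 * #|X|%:R ^+ 3).
Let A := flag_oracle xi0 X_gt0 qae l eta kappa.

Lemma card_ge1 : 1 <= #|X|%:R :> R.
Proof. by rewrite ler1n. Qed.

Let half_gt0 : 0 < 1 / 2 :> R. Proof. by rewrite divr_gt0. Qed.

Let accuracy_gt0 : 0 < 2 ^ (- bits eta) / 3 :> R.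
Proof. by rewrite divr_gt0 ?exprz_gt0. Qed.

Let risk01 : 0 < alpha < 1.
Proof. by have [] := qae_risk_bounds card_ge1 kappa01. Qed.

(** The lower bound [e0] makes the cost independent of the current region. The leading 1 pays for
    the query that prepares the data; the absolute value is there because the sign of [Cqae] is not
    prescribed. *)
Lemma queries_flag_oracle_le (e0 : R) : 0 < e0 <= eta ->
  (queries (pcirc A))%:R <=
  (1 + `|Cqae| * (1 + 6 / e0)) * (4 + 3 * ln #|X|%:R + 2 * ln kappa^-1).
Proof.
move=> /andP[e00 e0eta]; have /andP[k0 k1] := kappa01.
have lnalpha := ln_qae_risk card_ge1 kappa01.
have [qP _] := qaeP X xi0 (ltW half_gt0) accuracy_gt0 risk01.
rewrite queries_flag_oracle -add1n natrD [leRHS]mulrDl [1 * (_ + _)]mul1r.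
have /andP[y0 y6] := qae_accuracy_bounds eta_gt0.
have ye0 : 6 / eta <= 6 / e0 by rewrite ler_wpM2l // lef_pV2 // posrE.
have lna : 0 <= ln alpha^-1.
  by have /andP[a0 a1] := risk01; rewrite ln_ge0 // invf_ge1 // ltW.
have L1 : 1 <= 4 + 3 * ln #|X|%:R + 2 * ln kappa^-1.
  by apply: le_trans lnalpha; rewrite lerDl.
apply: (lerD L1); apply: le_trans qP _.
set y := 1 / 2 / _ in y0 y6 *.
apply: (@le_trans _ _ (`|Cqae| * (1 + y) * (1 + ln alpha^-1))).
  by rewrite !ler_wpM2r ?ler_norm // addr_ge0.
apply: ler_pM lnalpha; rewrite ?mulr_ge0 ?addr_ge0 //.
by rewrite ler_wpM2l // lerD2l (le_trans y6).
Qed.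

(** [q x] is the probability that the flag goes up on input [x]. These four facts are all that is
    used of the output state from here on. *)
Lemma flag_oracle_stats (I : problem R X Xi) (Q : unitary R (regs R X Xi)) :
  simulation_oracle I xi0 Q -> (forall x, stddev I x <= 1 / 2) ->
  exists q : X -> R, [/\ forall x, 0 <= q x <= 1,
    forall x, upper l eta <= mean I x -> 1 - alpha <= q x,
    forall x, mean I x <= lower l eta -> q x <= alpha
  & forall g : pred X,
      proj_sqnorm [pred b | flag b && g (solution b)] (output_state Q A) =
      (\sum_(x | g x) q x) / #|X|%:R].
Proof.
move=> QP sd.
have [_ /(_ I Q QP sd)] := qaeP X xi0 (ltW half_gt0) accuracy_gt0 risk01.
move=> /fin_all_exists[psi psiP].
exists (fun x => proj_sqnorm
  [pred p | (lower l eta + upper l eta) / 2 < qest p] (psi x)).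
split=> [x|x mx|x mx|g].
- rewrite proj_sqnorm_ge0; apply: le_trans (le_proj_sqnorm (q := predT) _ _) _ => //.
  by rewrite proj_sqnormT qvec_unit.
- have [_ /le_trans] := psiP x; apply; apply: le_proj_sqnorm => p /=.
  exact: flag_margin_above.
(* An accurate estimate now keeps the flag down, so the bound goes through the complementary
   event. *)
- have [_] := psiP x; have := qvec_unit (psi x).
  rewrite -(proj_sqnormC [pred p | (lower l eta + upper l eta) / 2 < qest p]).
  set s := proj_sqnorm _ _; set s' := proj_sqnorm [pred b | ~~ _] _ => ss1.
  move=> h; suff : 1 - alpha <= s' by lra.
  apply: le_trans h _; apply: le_proj_sqnorm => p /=.
  exact: flag_margin_below.
- exact: flag_oracle_proj QP (fun x => (psiP x).1).
Qed.

End FlagProbabilities.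

(** * Expectations over weighted outcomes, and their dependence on the fuel *)

Section Expectations.
Variable R : realType.
Implicit Types T U : Type.

(** After [cbind] the success probability of the continuation varies with the outcome, which a 0-1
    event cannot express; hence real-valued functions of the outcome. *)
Definition expect T (d : cdist R T) (phi : T * nat -> R) : R :=
  \sum_(w <- d) w.1 * phi w.2.

Definition nonneg T (d : cdist R T) : bool := all (fun w => 0 <= w.1) d.

Lemma probE T (d : cdist R T) (E : pred (T * nat)) :
  prob d E = expect d (fun w => (E w)%:R).
Proof.
rewrite /prob big_mkcond; apply: eq_bigr => w _.
by case: (E _); rewrite ?mulr1 ?mulr0.
Qed.

Lemma expect_ret T (x : T) (phi : T * nat -> R) :
  expect (cret R x) phi = phi (x, 0%N).
Proof. by rewrite /expect big_seq1 mul1r. Qed.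

Lemma expect_bind T U (d : cdist R T) (f : T -> cdist R U) phi :
  expect (cbind d f) phi =
  expect d (fun w => expect (f w.1) (fun r => phi (r.1, (w.2 + r.2)%N))).
Proof.
rewrite /expect /cbind big_flatten big_map; apply: eq_bigr => w _.
by rewrite big_map mulr_sumr; apply: eq_bigr => r _; rewrite mulrA.
Qed.

Lemma expect_charge T c (d : cdist R T) phi :
  expect (charge c d) phi = expect d (fun w => phi (w.1, (c * w.2)%N)).
Proof. by rewrite /expect big_map. Qed.

Lemma eq_expect T (d : cdist R T) phi psi :
  phi =1 psi -> expect d phi = expect d psi.
Proof. by move=> e; apply: eq_bigr => w _; rewrite e. Qed.

Lemma nonneg_bind T U (d : cdist R T) (f : T -> cdist R U) :
  nonneg d -> (forall x, nonneg (f x)) -> nonneg (cbind d f).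
Proof.
rewrite /nonneg => + f0; elim: d => [//|w d IH] /= /andP[w0 /IH d0].
rewrite /cbind /= all_cat d0 andbT all_map; apply: sub_all (f0 w.2.1) => r /=.
exact: mulr_ge0.
Qed.

Lemma nonneg_charge T c (d : cdist R T) : nonneg (charge c d) = nonneg d.
Proof. by rewrite /nonneg all_map. Qed.

Lemma le_expect T (d : cdist R T) (phi psi : T * nat -> R) : nonneg d ->
  (forall w, phi w <= psi w) -> expect d phi <= expect d psi.
Proof.
rewrite /expect => d0 le_phi; elim: d d0 => [|w d IH] /= => [_|/andP[w0 d0]].
  by rewrite !big_nil.
by rewrite !big_cons lerD ?IH // ler_wpM2l.
Qed.

Lemma expect_ge0 T (d : cdist R T) (phi : T * nat -> R) : nonneg d ->
  (forall w, 0 <= phi w) -> 0 <= expect d phi.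
Proof.
move=> d0 phi0; apply: le_trans (le_expect d0 phi0).
by rewrite /expect big1 // => w _; rewrite mulr0.
Qed.

Lemma expect_ge_prob T (d : cdist R T) (E : pred (T * nat)) phi (c : R) :
  nonneg d -> (forall w, 0 <= phi w) -> (forall w, E w -> c <= phi w) ->
  c * prob d E <= expect d phi.
Proof.
move=> d0 phi0 phiE.
have -> : c * prob d E = expect d (fun w => c * (E w)%:R).
  by rewrite probE mulr_sumr; apply: eq_bigr => w _; rewrite mulrCA.
apply: le_expect => // w.
by have [/phiE|_] := boolP (E w); rewrite ?mulr1 ?mulr0.
Qed.

Variables (X : finType) (Xi : choiceType) (Q : unitary R (regs R X Xi)).

Lemma run_nonneg O (p : qprog R X Xi O) n : nonneg (run Q p n).
Proof.
elim: n p => [|n IH] [o|B v c k] //=; rewrite ?/nonneg /= ?ler01 //.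
by apply: nonneg_bind => //; rewrite /nonneg all_map; apply/allP => b _ /=;
  apply: abs2_ge0.
Qed.

(** More fuel only adds outcomes: an execution cut off at fuel 0 contributes nothing. *)
Lemma le_run_expect O (p : qprog R X Xi O) (phi : O * nat -> R) n m :
  (n <= m)%N -> (forall w, 0 <= phi w) ->
  expect (run Q p n) phi <= expect (run Q p m) phi.
Proof.
elim: n m p phi => [|n IH] m p phi nm phi0.
  case: p => [o|B v c k]; first by case: m nm.
  by rewrite /= /expect big_nil; apply: expect_ge0 => //; apply: run_nonneg.
case: m nm => // m; rewrite ltnS => nm; case: p => [//|B v c k] /=.
rewrite !expect_bind; apply: le_expect => [|w]; last exact: IH.
by rewrite /nonneg all_map; apply/allP => b _ /=; apply: abs2_ge0.
Qed.

(** The supremum need not be attained, whence the loss [e]. Monotonicity in the fuel gives the bound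
    for all large [n], so that several such bounds can be met by one [n]. *)
Lemma Pr_eventually O (p : qprog R X Xi O) (E : pred (O * nat)) (c e : R) :
  (c%:E <= Pr (run Q p) E)%E -> 0 < e ->
  exists n0, forall n, (n0 <= n)%N -> c - e <= prob (run Q p n) E.
Proof.
move=> cE e0; have : ((c - e)%:E < Pr (run Q p) E)%E.
  by apply: lt_le_trans cE; rewrite lte_fin ltrBlDr ltrDl.
case/ereal_sup_gt => _ [n0 _ <-]; rewrite lte_fin => ltE.
exists n0 => n n0n; apply: le_trans (ltW ltE) _.
by rewrite !probE; apply: le_run_expect.
Qed.

(* amplify_spec bounds the probability of each outcome separately; these events
   are disjoint. *)
Lemma prob_eventually_sum (p : qprog R X Xi X) (f : X -> R) (g : pred X)
    (B e : R) : 0 < e ->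
  (forall x, ((f x)%:E <= Pr (run Q p)
     [pred r | (r.1 == x) && (r.2%:R <= B)%R])%E) ->
  exists n0, forall n, (n0 <= n)%N ->
    \sum_(x | g x) f x - e <= prob (run Q p n) [pred r | g r.1 && (r.2%:R <= B)].
Proof.
(* The loss is shared among the solutions; the successor keeps the denominator positive. *)
move=> e0 fP; pose e' := e / #|X|.+1%:R.
have e'0 : 0 < e' by rewrite divr_gt0 ?ltr0n.
have /fin_all_exists[n0 n0P] x := Pr_eventually (fP x) e'0.
exists (\max_x n0 x) => n n0n.
have -> : prob (run Q p n) [pred r | g r.1 && (r.2%:R <= B)] =
    \sum_(x | g x) prob (run Q p n) [pred r | (r.1 == x) && (r.2%:R <= B)].
  under eq_bigr do rewrite probE; rewrite probE exchange_big /=.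
  apply: eq_bigr => w _; rewrite -mulr_sumr; congr (_ * _).
  have [gw|gw] /= := boolP (g w.2.1).
    rewrite (bigD1 w.2.1) //= eqxx big1 ?addr0 // => x /andP[_].
    by rewrite eq_sym => /negPf->.
  rewrite big1 // => x gx; case: eqP => // e1.
  by rewrite e1 gx in gw.
apply: (@le_trans _ _ (\sum_(x | g x) (f x - e'))); last first.
  by apply: ler_sum => x _; apply: n0P; apply: leq_trans n0n; apply: leq_bigmax.
rewrite big_split /= sumrN lerD2l lerN2.
apply: (@le_trans _ _ (\sum_(x in X) e')).
  rewrite big_mkcond; apply: ler_sum => x _.
  by case: (g x); rewrite ?lexx ?ltW.
rewrite sumr_const -mulr_natl /e' mulrCA ler_piMr ?ltW //.
by rewrite ltr_pdivrMr ?ltr0n // mul1r ltr_nat.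
Qed.

End Expectations.

(** * Geometry and correctness of the search loop *)

Section RegionLoop.
Variables (R : realType) (X : finType) (Xi : choiceType) (xi0 : Xi).
Variable Qbar : unitary R (regs R (option X) Xi).
Variables (cbar : nat) (qae : qae_family R) (estimate : estimate_family R).
Variables (eps delta' ystar : R).
Hypotheses (eps_gt0 : 0 < eps) (delta'01 : 0 < delta' < 1).

(** The lower bound on the length keeps [eta] at least [eps / 32], also in the final stage, and
    hence the cost of QAE bounded. *)
Definition region_ok (a b : R) : bool :=
  [&& 0 <= a, b <= 1, eps / 8 <= b - a, a <= ystar & ystar <= b].

(** With [w = b - a] and [h] between [w / 16] and [w / 8], the new length is [w / 4 + 2 * h] or
    [3 / 4 * w - h], hence between [3 / 8 * w] and [11 / 16 * w]. *)
Lemma region_next_geometry (a b r : R) : eps / 2 <= b - a -> 0 <= a -> b <= 1 ->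
  let: (a', b') := region_next X a b r in
  [/\ 0 <= a', b' <= 1, eps / 8 <= b' - a' & b' - a' <= b - a - 5 * eps / 32].
Proof.
move=> ab a0 b1; have e0 := eps_gt0.
have eta0 : 0 < (b - a) / 4 by lra.
have [h1 h2] := bits_bounds eta0; rewrite /region_next lowerE upperE.
move: (2 ^ _) h1 h2 => h h1 h2.
by case: ifP => _; split; lra.
Qed.

Lemma region_shrinks (a b r : R) : region_ok a b -> eps / 2 <= b - a ->
  (region_next X a b r).2 - (region_next X a b r).1 <= b - a - 5 * eps / 32.
Proof.
case/and5P=> a0 b1 _ _ _ ab; have := region_next_geometry r ab a0 b1.
by case: region_next => a' b' [].
Qed.

Lemma region_next_ok (a b r : R) : region_ok a b -> eps / 2 <= b - a ->
  (region_next X a b r).1 <= ystar <= (region_next X a b r).2 ->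
  region_ok (region_next X a b r).1 (region_next X a b r).2.
Proof.
case/and5P=> a0 b1 _ _ _ ab /andP[]; have := region_next_geometry r ab a0 b1.
by case: region_next => a' b' [] *; apply/and5P.
Qed.

Let test := region_test xi0 Qbar cbar qae estimate delta'.
Let loop := region_loop xi0 Qbar cbar qae estimate eps delta'.

Lemma region_loop_stop n k t a b : b - a < eps / 2 ->
  loop n k t a b = cret R (a, b).
Proof. by move=> ab; rewrite /loop; case: k => [|k] /=; rewrite leNgt ab. Qed.

Lemma region_loop_step n k t a b : eps / 2 <= b - a ->
  loop n k.+1 t a b =
  cbind (test n t a b) (fun r => loop n k t.+1
    (region_next X a b r).1 (region_next X a b r).2).
Proof.
move=> ab; rewrite /loop /= ab /cbind; congr flatten; apply: eq_map => w.
by case: (region_next _ _ _ _).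
Qed.

Lemma region_test_nonneg n t a b : nonneg (test n t a b).
Proof. by rewrite /test nonneg_charge run_nonneg. Qed.

Lemma region_loop_nonneg n k t a b : nonneg (loop n k t a b).
Proof.
have [ab|ab] := ltP (b - a) (eps / 2).
  by rewrite region_loop_stop // /nonneg /= ler01.
elim: k t a b ab => [|k IH] t a b ab; first by rewrite /loop /= ab.
rewrite region_loop_step //; apply: nonneg_bind => [|r].
  exact: region_test_nonneg.
case: (region_next X a b r) => a' b' /=.
have [ab'|ab'] := ltP (b' - a') (eps / 2); last exact: IH.
by rewrite region_loop_stop // /nonneg /= ler01.
Qed.

(** [T0] bounds the number of rounds, [G] the queries of one round and [B] those of all rounds; [q]
    is a success probability guaranteed for the final stage. *)
Variables (T0 : nat) (G B q : R) (phi : nat -> (R * R) * nat -> R).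
Hypotheses (G_ge0 : 0 <= G) (q_ge0 : 0 <= q) (phi_ge0 : forall n w, 0 <= phi n w).

Hypothesis test_ok : forall t a b (e : R), (t < T0)%N -> region_ok a b ->
  eps / 2 <= b - a -> 0 < e ->
  exists E : pred (R * nat),
    (exists n0, forall n, (n0 <= n)%N ->
       1 - delta' / 2 ^+ t.+1 - e <= prob (test n t a b) E) /\
    forall r, E r -> r.2%:R <= G /\
      (region_next X a b r.1).1 <= ystar <= (region_next X a b r.1).2.

Hypothesis final_ok : forall a b, region_ok a b -> b - a < eps / 2 ->
  exists n0, forall n, (n0 <= n)%N -> forall c : nat, c%:R <= B ->
    q <= phi n ((a, b), c).

(* phi n (ab, c) is the probability that the rest of the algorithm, started from
   the region ab after c queries, succeeds with fuel n.  Passing it along keeps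
   the threshold on n uniform: each round has only two possible successors. *)
Lemma region_loop_ok j t a b : region_ok a b -> (t + j <= T0)%N ->
  b - a < eps / 2 + j%:R * (5 * eps / 32) ->
  exists n0, forall n k c, (n0 <= n)%N -> (j <= k)%N ->
    c%:R + j%:R * G <= B ->
    q * (1 - delta' / 2 ^+ t) <=
    expect (loop n k t a b) (fun r => phi n (r.1, (c + r.2)%N)).
Proof.
have [d0 d1] := andP delta'01.
have dt0 s : 0 < delta' / 2 ^+ s by rewrite divr_gt0 ?exprn_gt0.
have dt1 s : delta' / 2 ^+ s < 1.
  rewrite ltr_pdivrMr ?exprn_gt0 // mul1r; apply: lt_le_trans d1 _.
  by rewrite exprn_ege1 // ler1n.
(* A region that is already short is returned at once, whatever number of rounds is left. *)
have stop i s x y : region_ok x y -> y - x < eps / 2 ->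
    exists n0, forall n k c, (n0 <= n)%N -> (i <= k)%N ->
      c%:R + i%:R * G <= B -> q * (1 - delta' / 2 ^+ s) <=
      expect (loop n k s x y) (fun r => phi n (r.1, (c + r.2)%N)).
  move=> ok xy; have [n0 n0P] := final_ok ok xy.
  exists n0 => n k c n0n _ cB; rewrite region_loop_stop // expect_ret addn0 /=.
  have cB' : c%:R <= B by apply: le_trans cB; rewrite lerDl mulr_ge0.
  apply: le_trans (n0P n n0n c cB'); rewrite ler_piMr //.
  by rewrite gerBl ltW.
elim: j t a b => [|j IH] t a b ok tj ab.
  by apply: stop => //; rewrite mul0r addr0 in ab.
have [ab2|ab2] := ltP (b - a) (eps / 2); first exact: stop.
(* The loss dt ^ 2 is affordable:
   (1 - dt) * (1 - dt - dt ^ 2) >= 1 - 2 * dt = 1 - delta' / 2 ^ t. *)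
set dt := delta' / 2 ^+ t.+1; have dt20 : 0 < dt ^+ 2 by apply/exprn_gt0/dt0.
have tT : (t < T0)%N by apply: leq_trans tj; rewrite -addn1 leq_add2l.
have [E [[n1 n1P] EP]] := test_ok tT ok ab2 dt20.
(* The update depends on [r] only through its comparison with the cutoff; cutoff plus one and zero
   represent the two outcomes. *)
pose br (s : bool) : R * R :=
  region_next X a b (if s then 3 / (2 * (#|X|%:R + 1)) + 1 else 0).
have brE r : exists s, region_next X a b r = br s.
  exists (3 / (2 * (#|X|%:R + 1)) < r); rewrite /br /region_next.
  case: ifP => _; first by rewrite ltrDl ltr01.
  by rewrite ltNge divr_ge0 ?mulr_ge0 ?addr_ge0.
(* A successor that violates the invariant gets the dummy threshold 0. *)
have next_ok s : exists n0, region_ok (br s).1 (br s).2 -> forall n k c,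
    (n0 <= n)%N -> (j <= k)%N -> c%:R + j%:R * G <= B ->
    q * (1 - dt) <= expect (loop n k t.+1 (br s).1 (br s).2)
      (fun r => phi n (r.1, (c + r.2)%N)).
  have [okr|nokr] := boolP (region_ok (br s).1 (br s).2); last by exists 0%N.
  have [||n0 n0P] := IH t.+1 _ _ okr; first by rewrite addSnnS.
    apply: le_lt_trans (region_shrinks _ ok ab2) _.
    by move: ab; rewrite -[j.+1]addn1 natrD mulrDl mul1r => ab'; lra.
  by exists n0.
have [n2 n2P] := next_ok true; have [n3 n3P] := next_ok false.
exists (maxn n1 (maxn n2 n3)) => n k c.
rewrite !geq_max => /and3P[n1n n2n n3n]; case: k => // k; rewrite ltnS => jk cB.
rewrite region_loop_step // expect_bind.
apply: (@le_trans _ _ (q * (1 - dt) * prob (test n t a b) E)).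
  have dt_le1 : 0 <= 1 - dt by rewrite subr_ge0 ltW // dt1.
  apply: le_trans (ler_wpM2l (mulr_ge0 q_ge0 dt_le1) (n1P n n1n)).
  rewrite -/dt -mulrA ler_wpM2l //.
  have -> : delta' / 2 ^+ t = 2 * dt.
    by rewrite /dt exprS; field; rewrite expf_neq0.
  have key (x : R) : 0 < x -> 1 - 2 * x <= (1 - x) * (1 - x - x ^+ 2).
    by move=> x0; have := mulr_ge0 (sqr_ge0 x) (ltW x0); lra.
  exact/key/dt0.
apply: expect_ge_prob => [|w|[r c'] Ec].
- exact: region_test_nonneg.
- by apply: expect_ge0; rewrite ?region_loop_nonneg.
have [c'G ystar_in] := EP _ Ec.
have okr := region_next_ok ok ab2 ystar_in.
(* One of the [j.+1] budgets [G] pays for the queries [c'] of this round. *)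
have cB' : (c + c')%:R + j%:R * G <= B.
  apply: le_trans cB; rewrite -[j.+1]addn1 !natrD mulrDl mul1r.
  by rewrite -addrA lerD2l addrC lerD2l.
rewrite (@eq_expect _ _ _ _ (fun w => phi n (w.1, (c + c' + w.2)%N))); last first.
  by move=> w /=; rewrite addnA.
have [s brs] := brE r; rewrite /= in okr *; rewrite brs in okr *.
by case: s okr {brs} => okr; [apply: n2P | apply: n3P].
Qed.

End RegionLoop.

(** * Thresholds and total flagged mass *)

(** This is why the final stage uses [l = a - 3 / 4 * eta]: its upper threshold is then at most [a].
    In the search it puts the upper threshold below 1, so the auxiliary solution is flagged. *)
Lemma upper_le (R : realType) (l eta : R) : 0 < eta ->
  upper l eta <= l + 3 / 4 * eta.
Proof.
move=> /bits_bounds[h1 _]; rewrite upperE.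
by move: (2 ^ _) h1 => h h1; lra.
Qed.

Lemma lower_ge (R : realType) (l eta : R) : 0 < eta -> l <= lower l eta.
Proof.
move=> /bits_bounds[_ h2]; rewrite lowerE.
by move: (2 ^ _) h2 => h h2; lra.
Qed.

Section FlaggedMass.
Variables (R : realType) (Xi : choiceType) (xi0 : Xi).
Variables (qae : qae_family R) (Cqae : R) (qaeP : qae_spec Cqae qae).

Lemma p_labelE (X : finType) (Q : unitary R (regs R X Xi)) (A : qproc R X Xi) :
  p_label Q A =
  proj_sqnorm [pred b | flag b && predT (solution b)] (output_state Q A).
Proof.
by rewrite /p_label !proj_sqnormE; apply: eq_bigr => b _; rewrite /= andbT.
Qed.

Lemma invr_sqrt_le (N p : R) : 1 <= N -> (4 * N)^-1 <= p ->
  (Num.sqrt p)^-1 <= 2 * Num.sqrt N.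
Proof.
move=> N1 Np; have N0 : 0 < N by apply: lt_le_trans N1.
have s0 : 0 < 2 * Num.sqrt N by rewrite mulr_gt0 ?sqrtr_gt0.
have p0 : 0 < p by apply: lt_le_trans Np; rewrite invr_gt0 mulr_gt0.
rewrite -[leRHS]invrK lef_pV2 ?posrE ?invr_gt0 ?sqrtr_gt0 //.
have -> : (2 * Num.sqrt N)^-1 = Num.sqrt (4 * N)^-1.
  rewrite sqrtrV ?mulr_ge0 ?ltW // sqrtrM //.
  by have -> : 4 = 2 ^+ 2 :> R by [ring]; rewrite sqrtr_sqr ger0_norm.
by rewrite ler_sqrt // ltW.
Qed.

Lemma mean_augment_None (X : finType) (I : problem R X Xi) :
  mean (augment xi0 I) None = 1.
Proof.
rewrite /mean /= -[RHS](augment_sum1 I xi0 None) /=.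
by apply: eq_bigr => xi _; rewrite mulr1.
Qed.

Variables (X : finType) (I : problem R X Xi) (xstar : X).
Hypothesis Y01 :
  forall x xi, xi \in msupp (pmf I x) -> 0 <= Yfun I x xi <= 1.
Hypothesis xstar_max : forall x, mean I x <= mean I xstar.

(** Let [S] be the sum of all flagging probabilities, so that [p = S / (N + 1)]. Wrong flags add at
    most 1/400 to [S]. If [xstar] is below [lower], then [r] is at most
    [11 / 10 * (1 + 1 / 400) / (N + 1)]; if it is above [upper], then [r] is at least
    [9 / 10 * 2 * (1 - 1 / 400) / (N + 1)]. The factor 3/2 of the cutoff lies strictly between. *)
Lemma region_test_sound (Qbar : unitary R (regs R (option X) Xi))
    (a b kappa : R) :
  simulation_oracle (augment xi0 I) xi0 Qbar ->
  a < b -> b <= 1 -> a <= mean I xstar -> mean I xstar <= b ->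
  0 < kappa <= 1 / 10 ->
  let A := flag_oracle xi0 (card_option_gt0 X) qae ((a + b) / 2) ((b - a) / 4)
             kappa in
  let p := p_label Qbar A in
  (4 * #|X|%:R)^-1 <= p /\
  forall r, `|r - p| <= 1 / 10 * p ->
    (region_next X a b r).1 <= mean I xstar <= (region_next X a b r).2.
Proof.
move=> QP ab b1 ay yb /andP[k0 k1] A p.
have eta0 : 0 < (b - a) / 4 by rewrite divr_gt0 // subr_gt0.
have k01 : 0 < kappa < 1 by apply/andP; split=> //; lra.
have sd x : stddev (augment xi0 I) x <= 1 / 2.
  apply: stddev_le_half => xi; case: x => [x|] /=; first exact: Y01.
  by rewrite ler01 lexx.
have [q [q01 q_hi q_lo qE]] :=
  flag_oracle_stats (card_option_gt0 X) qaeP ((a + b) / 2) ((b - a) / 4) k01 QP sd.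
have X1 : 1 <= #|{: option X}|%:R :> R by rewrite card_option ler1n.
have [/andP[al0 _] Nal al] := qae_risk_bounds X1 k01.
move: (kappa ^+ 2 / (4 * _)) q_hi q_lo al0 Nal al => alpha q_hi q_lo al0 Nal al.
have k2 : kappa ^+ 2 / 4 <= 1 / 400.
  by have := mulr_ge0 (ltW k0) (ltW k0); nra.
pose S := \sum_x q x.
have pE : p = S / #|{: option X}|%:R.
  by rewrite /p p_labelE (qE predT).
have N1E : #|{: option X}|%:R = #|X|%:R + 1 :> R by rewrite card_option natr1.
rewrite N1E in X1 Nal pE; set N := #|X|%:R : R.
have X_gt0 : 1 <= N by rewrite /N ler1n; apply/card_gt0P; exists xstar.
have q0 x : 0 <= q x by case/andP: (q01 x).
have qNone : 1 - alpha <= q None.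
  apply: q_hi; rewrite mean_augment_None.
  by apply: le_trans (upper_le _ eta0) _; lra.
have S_ge : 1 - alpha <= S.
  apply: le_trans qNone _; rewrite /S (bigD1 None) //= lerDl.
  exact: sumr_ge0.
(* Here [N + 1 <= 2 * N] and [1 - alpha >= 1 / 2]. *)
have [p_ge thr] : (4 * N)^-1 <= p /\ 0 < (N + 1)^-1.
  have i0 : 0 < (N + 1)^-1 by rewrite invr_gt0; lra.
  split=> //; rewrite pE -/N ler_pdivlMr; last by lra.
  apply: le_trans S_ge; rewrite mulrC ler_pdivrMr; last by lra.
  by nra.
split=> // r; rewrite /region_next.
have -> : 3 / (2 * (#|X|%:R + 1)) = 3 / 2 * (N + 1)^-1.
  by rewrite -/N; field; lra.
rewrite pE -/N; move: (N + 1)^-1 thr => i i0; rewrite ler_norml => /andP[r1 r2].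
have S0 : 0 <= S by apply: sumr_ge0.
case: ifP => [thr_r|/negbT thr_r] /=.
  rewrite yb andbT leNgt; apply/negP => ylow.
  have S_le : S <= 1 + (N + 1) * alpha.
    rewrite /S (bigD1 None) //=; apply: lerD; first by case/andP: (q01 None).
    rewrite -N1E mulr_natl -sumr_const [leRHS](bigD1 None) //=.
    apply: ler_wpDl; first exact: ltW.
    apply: ler_sum => -[x|] // _; apply: q_lo; apply: ltW.
    exact: le_lt_trans (xstar_max x) ylow.
  have : 3 / 2 * i < 11 / 10 * S * i by apply: lt_le_trans thr_r _; lra.
  by rewrite ltr_pM2r // => ?; rewrite -/N in Nal; lra.
rewrite ay /= leNgt; apply/negP => yhigh.
have S_ge2 : 2 * (1 - alpha) <= S.
  rewrite /S (bigD1 None) //= (bigD1 (Some xstar)) //= addrA -[leLHS]addr0.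
  apply: lerD; last exact: sumr_ge0.
  have qx : 1 - alpha <= q (Some xstar) by apply: q_hi; apply: ltW.
  lra.
have : 9 / 10 * S * i <= 3 / 2 * i by rewrite -leNgt in thr_r; lra.
by rewrite ler_pM2r // => ?; lra.
Qed.

(** The solutions that are not [eps]-optimal carry flagged mass at most [kappa ^+ 2 / 4];
    normalization divides it by [S], which is at least 1/2. *)
Lemma final_flag_sound (X_gt0 : (0 < #|X|)%N) (Q : unitary R (regs R X Xi))
    (a b eps kappa : R) :
  simulation_oracle I xi0 Q ->
  a < b -> a <= mean I xstar -> mean I xstar <= b ->
  b - a < eps / 2 -> 0 < kappa <= 1 / 10 ->
  let eta := (b - a) / 4 in
  let A := flag_oracle xi0 X_gt0 qae (a - 3 / 4 * eta) eta kappa in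
  (4 * #|X|%:R)^-1 <= p_label Q A /\
  1 - kappa ^+ 2 / 2 <=
    \sum_(x | mean I xstar - eps <= mean I x) flagged_law Q A x.
Proof.
move=> QP ab ay yb abe /andP[k0 k1] eta A.
have eta0 : 0 < eta by rewrite divr_gt0 // subr_gt0.
have k01 : 0 < kappa < 1 by apply/andP; split=> //; lra.
have sd x : stddev I x <= 1 / 2 by apply: stddev_le_half; apply: Y01.
have [q [q01 q_hi q_lo qE]] :=
  flag_oracle_stats X_gt0 qaeP (a - 3 / 4 * eta) eta k01 QP sd.
have N1 : 1 <= #|X|%:R :> R by rewrite ler1n.
have [/andP[al0 _] Nal al] := qae_risk_bounds N1 k01.
move: (kappa ^+ 2 / (4 * _)) q_hi q_lo al0 Nal al => alpha q_hi q_lo al0 Nal al.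
have k2 : kappa ^+ 2 <= 1 / 100.
  by have := mulr_ge0 (ltW k0) (ltW k0); nra.
have N0 : 0 < #|X|%:R :> R by apply: lt_le_trans N1.
pose S := \sum_x q x.
have pE : p_label Q A = S / #|X|%:R by rewrite p_labelE (qE predT).
have q0 x : 0 <= q x by case/andP: (q01 x).
have S_ge : 1 - alpha <= S.
  rewrite /S (bigD1 xstar) //= -[leLHS]addr0; apply: lerD; last exact: sumr_ge0.
  by apply: q_hi; apply: le_trans (upper_le _ eta0) _; lra.
have S0 : 0 < S by apply: lt_le_trans S_ge; lra.
split.
  rewrite pE; move: (#|X|%:R : R) N1 N0 => N N1 N0.
  by rewrite ler_pdivlMr // invfM mulfVK ?gt_eqF //; lra.
have flagE x : flagged_law Q A x = q x / S.
  rewrite /flagged_law pE.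
  rewrite (qE (pred1 x)) big_pred1_eq.
  by field; rewrite !gt_eqF.
under eq_bigr do rewrite flagE.
rewrite -mulr_suml ler_pdivlMr //.
have : S = \sum_(x | mean I xstar - eps <= mean I x) q x
    + \sum_(x | ~~ (mean I xstar - eps <= mean I x)) q x.
  by rewrite /S (bigID (fun x => mean I xstar - eps <= mean I x)).
have : \sum_(x | ~~ (mean I xstar - eps <= mean I x)) q x <= kappa ^+ 2 / 4.
  apply: le_trans Nal; rewrite mulr_natl -sumr_const [leRHS]big_mkcond.
  rewrite [leLHS]big_mkcond; apply: ler_sum => x _ /=.
  have [_|bad] := boolP (mean I xstar - eps <= mean I x); first exact: ltW.
  (* Such an [x] has mean below [b - eps], and [b - eps <= a - 3 / 16 * (b - a)] because
     [b - a < eps / 2]. *)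
  apply: q_lo; apply: le_trans (lower_ge _ eta0).
  by move: bad; rewrite -ltNge /eta => bad; lra.
move: (\sum_(x | ~~ _) _) => bad bad_le.
move: (\sum_(x | _) _) => good SE.
have : 0 <= kappa ^+ 2 * (S - 1 / 2).
  by rewrite mulr_ge0 ?sqr_ge0 // subr_ge0; lra.
by lra.
Qed.

End FlaggedMass.

(** * Elementary bounds on query costs and on the probability slack *)

Section QueryCosts.
Variable R : realType.

(** Serves both subroutines: [e] is the relative accuracy for estimation and 1 for amplification,
    and [z] is the logarithmic risk factor. *)
Lemma query_bound_le (C T T' e p N z Z : R) : 0 < e -> 0 <= T <= T' ->
  1 <= N -> (4 * N)^-1 <= p -> 0 <= z <= Z ->
  C * (T / (e * Num.sqrt p)) * z <= `|C| * (T' * (2 * Num.sqrt N) / e) * Z.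
Proof.
move=> e0 /andP[T0 TT'] N1 Np /andP[z0 zZ].
have sN := invr_sqrt_le N1 Np.
have -> : T / (e * Num.sqrt p) = T * (Num.sqrt p)^-1 / e.
  by rewrite invfM mulrA mulrAC.
have y0 : 0 <= T * (Num.sqrt p)^-1 / e.
  by rewrite divr_ge0 ?(ltW e0) // mulr_ge0 ?invr_ge0 ?sqrtr_ge0.
apply: (@le_trans _ _ (`|C| * (T * (Num.sqrt p)^-1 / e) * z)).
  by rewrite !ler_wpM2r ?ler_norm.
apply: ler_pM => //; first exact: mulr_ge0.
rewrite ler_wpM2l // ler_pM2r ?invr_gt0 //.
by apply: ler_pM; rewrite ?invr_ge0 ?sqrtr_ge0.
Qed.

Lemma ln_risk_div (c d : R) : 0 < c -> 0 < d -> ln (d / c)^-1 <= c + ln d^-1.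
Proof.
move=> c0 d0; rewrite invf_div lnM ?posrE ?invr_gt0 // lerD2r.
exact/ltW/ln_sublinear.
Qed.

Lemma ln_natX2 (n : nat) : ln (2 ^+ n : R) <= n%:R.
Proof.
rewrite lnXn // -[ln 2 *+ n]mulr_natl ler_piMr //.
by have -> : 2 = 1 + 1 :> R by [ring]; apply: le_ln1Dx; lra.
Qed.

Lemma ln_succ_le (N : R) : 1 <= N -> ln (N + 1) <= 1 + ln N.
Proof.
move=> N1; have N0 : 0 < N by apply: lt_le_trans N1.
apply: (@le_trans _ _ (ln (2 * N))).
  by rewrite ler_ln ?posrE; lra.
by rewrite lnM ?posrE // lerD2r; have := ln_natX2 1; rewrite expr1.
Qed.

Lemma half01 (x : R) : 0 < x < 1 -> 0 < x / 2 < 1.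
Proof. by move=> /andP[x0 x1]; apply/andP; split; lra. Qed.

(** The three losses are the failure of amplification, the flagged mass on bad solutions for
    [kappa = x / 100], and the finite fuel. *)
Lemma amplify_slack (x s : R) : 0 < x < 1 -> 1 - (x / 100) ^+ 2 / 2 <= s ->
  1 - x / 2 - x ^+ 2 / 4 <= (1 - x / 2) * s - x ^+ 2 / 8.
Proof.
move=> /andP[x0 x1] s_ge.
have : 0 <= (1 - x / 2) * (s - (1 - (x / 100) ^+ 2 / 2)).
  by rewrite mulr_ge0 ?subr_ge0 //; lra.
have : 0 <= x ^+ 2 by rewrite exprn_ge0 // ltW.
have : 0 <= x ^+ 3 by rewrite exprn_ge0 // ltW.
lra.
Qed.

(** The quadratic terms cancel: the product equals [1 - x + x ^+ 3 / 8]. *)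
Lemma two_stage_slack (x : R) : 0 < x < 1 -> 0 <= 1 - x / 2 - x ^+ 2 / 4 /\
  1 - x <= (1 - x / 2 - x ^+ 2 / 4) * (1 - x / 2).
Proof. by move=> /andP[x0 x1]; split; nra. Qed.

Lemma le_prob T (d : cdist R T) (E F : pred (T * nat)) : nonneg d ->
  (forall w, E w -> F w) -> prob d E <= prob d F.
Proof.
move=> d0 EF; rewrite !probE; apply: le_expect => // w.
by rewrite ler_nat; case: (E w) (EF w) => // ->.
Qed.

End QueryCosts.

(** * Success probability and cost of each stage *)

Section Stages.
Variables (R : realType) (qae : qae_family R) (amplify : amplify_family R).
Variables (estimate : estimate_family R) (Cqae Camp Cest : R).
Hypotheses (qaeP : qae_spec Cqae qae) (amplifyP : amplify_spec Camp amplify).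
Hypothesis estimateP : estimate_spec Cest estimate.
Variables (X : finType) (Xi : choiceType) (xi0 : Xi) (X_gt0 : (0 < #|X|)%N).
Variables (I : problem R X Xi) (xstar : X).
Hypothesis Y01 :
  forall x xi, xi \in msupp (pmf I x) -> 0 <= Yfun I x xi <= 1.
Hypothesis xstar_max : forall x, mean I x <= mean I xstar.
Variables (eps delta : R).
Hypotheses (eps_gt0 : 0 < eps) (delta01 : 0 < delta < 1).

Let KT : R := 1 + `|Cqae| * (1 + 6 / (eps / 32)).
Let L : R := 1 + ln #|X|%:R + ln delta^-1.

Let N1 : 1 <= #|X|%:R :> R. Proof. by rewrite ler1n. Qed.

Let lnN_ge0 : 0 <= ln (#|X|%:R : R). Proof. exact: ln_ge0. Qed.

Let lnd_ge0 : 0 <= ln delta^-1.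
Proof. by have /andP[d0 d1] := delta01; rewrite ln_ge0 // invf_ge1 // ltW. Qed.

Let KT_ge0 : 0 <= KT.
Proof. by rewrite addr_ge0 // mulr_ge0 // addr_ge0 // !divr_ge0 // ltW. Qed.

(** [M * L] bounds both logarithmic factors: that of QAE is at most
    [29 + 2 * T0 + 3 * ln N + 2 * ln delta^-1], with [N] the number of solutions, and that of the
    estimation risk is smaller. *)
Lemma region_test_eventually (Qbar : unitary R (regs R (option X) Xi))
    (cbar T0 t : nat) (a b e : R) :
  simulation_oracle (augment xi0 I) xi0 Qbar ->
  (t < T0)%N -> region_ok eps (mean I xstar) a b -> eps / 2 <= b - a ->
  0 < e ->
  let M := 2 * T0%:R + 40 in
  let G := cbar%:R * (`|Cest| * (KT * (M * L) * (2 * Num.sqrt #|X|%:R)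
                                  / (1 / 10)) * (M * L)) in
  exists E : pred (R * nat),
    (exists n0, forall n, (n0 <= n)%N -> 1 - delta / 2 / 2 ^+ t.+1 - e <=
       prob (region_test xi0 Qbar cbar qae estimate (delta / 2) n t a b) E) /\
    forall r, E r -> r.2%:R <= G /\
      (region_next X a b r.1).1 <= mean I xstar <= (region_next X a b r.1).2.
Proof.
move=> QP tT /and5P[a0 b1 _ ay yb] ab e0 M G.
have [d0 d1] := andP delta01; have eps0 := eps_gt0.
set dt := delta / 2 / 2 ^+ t.+1.
have X2 : 1 <= 2 ^+ t.+1 :> R by rewrite exprn_ege1 // ler1n.
have X20 : 0 < 2 ^+ t.+1 :> R by rewrite exprn_gt0.
have dt01 : 0 < dt < 1.
  rewrite /dt divr_gt0 ?divr_gt0 //= ltr_pdivrMr // mul1r.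
  by apply: lt_le_trans X2; lra.
have [dt0 dt1] := andP dt01.
have k01 : 0 < dt / 10 <= 1 / 10 by apply/andP; split; lra.
have k01' : 0 < dt / 10 < 1 by apply/andP; split; lra.
have altb : a < b by lra.
have [p_ge sound] :=
  region_test_sound qaeP Y01 xstar_max QP altb b1 ay yb k01.
have eta0 : 0 < (b - a) / 4 by lra.
have e32 : 0 < eps / 32 <= (b - a) / 4 by apply/andP; split; lra.
have NS : #|{: option X}|%:R = #|X|%:R + 1 :> R by rewrite card_option natr1.
have := queries_flag_oracle_le xi0 (card_option_gt0 X) qaeP ((a + b) / 2)
  eta0 k01' e32; rewrite -/KT NS.
set A := flag_oracle _ _ _ _ _ _ => T_le.
(* Here [dt = delta / 2 ^+ t.+2] and [t + 2 <= T0 + 1], so halving the risk in every round costs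
   only a constant. *)
have lndt : ln dt^-1 <= T0%:R + 1 + ln delta^-1.
  have -> : dt = delta / 2 ^+ t.+2 by rewrite /dt [2 ^+ t.+2]exprS invfM mulrA.
  rewrite invf_div lnM ?posrE ?invr_gt0 ?exprn_gt0 // lerD2r.
  by apply: le_trans (ln_natX2 _ _) _; rewrite natr1 ler_nat.
have lnk : ln (dt / 10)^-1 <= 10 + ln dt^-1 by apply: ln_risk_div.
have lnS := ln_succ_le N1.
have T0_ge0 : 0 <= T0%:R :> R by [].
have TL_ge0 : 0 <= T0%:R * ln #|X|%:R :> R by rewrite mulr_ge0.
have Td_ge0 : 0 <= T0%:R * ln delta^-1 by rewrite mulr_ge0.
have lnN0 := lnN_ge0; have lnd0 := lnd_ge0.
have T_le' : (queries (pcirc A))%:R <= KT * (M * L).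
  apply: le_trans T_le _; rewrite ler_wpM2l // /M /L.
  move: (ln (_ + 1)) (ln (dt / 10)^-1) (ln dt^-1) lnk lnS lndt => x y z.
  move: (ln #|X|%:R) (ln delta^-1) (T0%:R) lnN0 lnd0 T0_ge0 TL_ge0 Td_ge0.
  by move=> *; lra.
have z_le : 0 <= 1 + ln dt^-1 <= M * L.
  have lndt0 : 0 <= ln dt^-1 by rewrite ln_ge0 // invf_ge1 // ltW.
  apply/andP; split; first by rewrite addr_ge0.
  rewrite /M /L; move: (ln dt^-1) lndt => z.
  move: (ln #|X|%:R) (ln delta^-1) (T0%:R) lnN0 lnd0 T0_ge0 TL_ge0 Td_ge0.
  by move=> *; lra.
have T01 : 0 <= ((queries (pcirc A))%:R : R) <= KT * (M * L).
  by apply/andP; split; first exact: ler0n.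
have e10 : 0 < 1 / 10 :> R by rewrite divr_gt0.
have cost_le := query_bound_le Cest e10 T01 N1 p_ge z_le.
have p0 : 0 < p_label Qbar A.
  by apply: lt_le_trans p_ge; rewrite invr_gt0 mulr_gt0 // ltr0n.
have e101 : 0 < (1 / 10 : R) < 1.
  by rewrite e10 ltr_pdivrMr // mul1r ltr1n.
have := Pr_eventually (@estimateP _ _ A (1 / 10) dt Qbar e101 dt01 p0) e0.
set Espec := [pred r | _ && _] => -[n0 n0P].
pose E := [pred r : R * nat |
  (`|r.1 - p_label Qbar A| <= 1 / 10 * p_label Qbar A) && (r.2%:R <= G)].
(* The estimation counts queries to [Qbar], each charged as [cbar] queries. *)
have EspecE (r : R * nat) : Espec r -> E (r.1, (cbar * r.2)%N).
  case/andP=> rp r_le; rewrite /E /= rp natrM /G ler_wpM2l //.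
  exact: le_trans r_le cost_le.
exists E; split.
  exists n0 => n /n0P h; apply: le_trans h _.
  rewrite /region_test !probE expect_charge.
  apply: le_expect => [|r]; first exact: run_nonneg.
  by rewrite ler_nat; case: (Espec r) (EspecE r) => // ->.
by move=> r /andP[rp rG]; split=> //; apply: sound.
Qed.

(** The constant 204 is 4 from the QAE risk plus twice the 100 that bounds the logarithm of 100; the
    3 in [3 * L] is 1 plus the 2 that bounds [ln 2]. *)
Lemma amplify_eventually (Q : unitary R (regs R X Xi)) (a b : R) :
  simulation_oracle I xi0 Q ->
  region_ok eps (mean I xstar) a b -> b - a < eps / 2 ->
  let eta := (b - a) / 4 in
  let A := flag_oracle xi0 X_gt0 qae (a - 3 / 4 * eta) eta (delta / 100) in
  let C := `|Camp| * (KT * (204 * L) * (2 * Num.sqrt #|X|%:R) / 1) * (3 * L) in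
  exists n0, forall n, (n0 <= n)%N ->
    1 - delta / 2 - delta ^+ 2 / 4 <=
    prob (run Q (amplify A (delta / 2)) n)
      [pred r | (mean I xstar - eps <= mean I r.1) && (r.2%:R <= C)].
Proof.
move=> QP /and5P[a0 b1 ab ay yb] abe eta A C.
have [d0 d1] := andP delta01; have eps0 := eps_gt0.
have k01 : 0 < delta / 100 <= 1 / 10 by apply/andP; split; lra.
have k01' : 0 < delta / 100 < 1 by apply/andP; split; lra.
have altb : a < b by lra.
have [p_ge law_ge] := final_flag_sound qaeP Y01 X_gt0 QP altb ay yb abe k01.
have eta0 : 0 < eta by rewrite /eta; lra.
have e32 : 0 < eps / 32 <= eta by rewrite /eta; apply/andP; split; lra.
have := queries_flag_oracle_le xi0 X_gt0 qaeP (a - 3 / 4 * eta) eta0 k01' e32.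
rewrite -/KT -/A => T_le.
have lnk : ln (delta / 100)^-1 <= 100 + ln delta^-1 by apply: ln_risk_div.
have lnd2 : ln (delta / 2)^-1 <= 2 + ln delta^-1 by apply: ln_risk_div.
have lnN0 := lnN_ge0; have lnd0 := lnd_ge0.
have T01 : 0 <= ((queries (pcirc A))%:R : R) <= KT * (204 * L).
  apply/andP; split; first exact: ler0n.
  apply: le_trans T_le _; rewrite ler_wpM2l // /L.
  move: (ln (delta / 100)^-1) lnk => x.
  by move: (ln #|X|%:R) (ln delta^-1) lnN0 lnd0; move=> *; lra.
have d201 := half01 delta01.
have z_le : 0 <= 1 + ln (delta / 2)^-1 <= 3 * L.
  have ln0 : 0 <= ln (delta / 2)^-1.
    by have /andP[h0 h1] := d201; rewrite ln_ge0 // invf_ge1 // ltW.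
  apply/andP; split; first by rewrite addr_ge0.
  rewrite /L; move: (ln (delta / 2)^-1) lnd2 => x.
  by move: (ln #|X|%:R) (ln delta^-1) lnN0 lnd0; move=> *; lra.
have cost_le := query_bound_le Camp ltr01 T01 N1 p_ge z_le.
rewrite mul1r in cost_le.
have p0 : 0 < p_label Q A.
  by apply: lt_le_trans p_ge; rewrite invr_gt0 mulr_gt0 // ltr0n.
have d8 : 0 < delta ^+ 2 / 8 by rewrite divr_gt0 ?exprn_gt0.
have [n0 n0P] := prob_eventually_sum
  (fun x => mean I xstar - eps <= mean I x) d8
  (@amplifyP _ _ A (delta / 2) Q d201 p0).
exists n0 => n /n0P h; apply: le_trans (le_trans h _); last first.
  apply: le_prob => [|r]; first exact: run_nonneg.
  by move=> /andP[rg rc]; rewrite /= rg; apply: le_trans rc cost_le.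
by rewrite -mulr_sumr; apply: amplify_slack.
Qed.

End Stages.

(** * The two stages combined *)

Theorem theorem1 (R : realType)
    (qae : qae_family R) (amplify : amplify_family R)
    (estimate : estimate_family R) (Cqae Camp Cest : R)
    (qaeP : qae_spec Cqae qae) (amplifyP : amplify_spec Camp amplify)
    (estimateP : estimate_spec Cest estimate) (cbar : nat)
    (eps : R) (eps_gt0 : 0 < eps) (eps_lt1 : eps < 1) :
  exists (K : R) (k : nat),
  forall (X : finType) (Xi : choiceType) (xi0 : Xi) (X_gt0 : (0 < #|X|)%N)
    (I : problem R X Xi)
    (Q : unitary R (regs R X Xi)) (Qbar : unitary R (regs R (option X) Xi))
    (xstar : X) (delta : R),
  simulation_oracle I xi0 Q ->
  simulation_oracle (augment xi0 I) xi0 Qbar ->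
  (forall x xi, xi \in msupp (pmf I x) -> 0 <= Yfun I x xi <= 1) ->
  (forall x, mean I x <= mean I xstar) ->
  0 < delta < 1 ->
  let bound :=
    K * Num.sqrt #|X|%:R * (1 + ln #|X|%:R + ln delta^-1) ^+ k in
  let E := [pred r : X * nat |
             (mean I xstar - eps <= mean I r.1) && (r.2%:R <= bound)] in
  ((1 - delta)%:E <=
     Pr (sogas xi0 X_gt0 Q Qbar cbar qae amplify estimate eps delta) E)%E.
Proof.
have eps0 := eps_gt0.
(* Every round shortens the region by at least [5 * eps / 32], and the initial length is 1. *)
pose T0 := Num.Def.archi_bound (32 / (5 * eps)).
have T0P : 1 < T0%:R * (5 * eps / 32).
  have := archi_boundP (divr_ge0 (ler0n R 32) (mulr_ge0 (ler0n R 5) (ltW eps0))).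
  rewrite -/T0 => T0_gt; have e1 : 0 < 5 * eps / 32 by lra.
  rewrite -(@ltr_pM2r _ (5 * eps / 32)) // in T0_gt.
  apply: le_lt_trans T0_gt; rewrite le_eqVlt; apply/orP; left; apply/eqP.
  by field; rewrite gt_eqF.
pose KT : R := 1 + `|Cqae| * (1 + 6 / (eps / 32)).
pose M : R := 2 * T0%:R + 40.
(* The constants are [20 = 2 * 10] and [1224 = 204 * 2 * 3]. The exponent 2 below counts one
   logarithm for QAE and one for the risk of estimation or amplification. *)
pose K := T0%:R * (cbar%:R * (`|Cest| * KT * M ^+ 2 * 20))
  + `|Camp| * KT * 1224.
exists K, 2%N.
move=> X Xi xi0 X_gt0 I Q Qbar xstar delta QP QbarP Y01 xstar_max delta01.
pose L := 1 + ln #|X|%:R + ln delta^-1.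
pose bound := K * Num.sqrt #|X|%:R * L ^+ 2.
pose E := [pred r : X * nat |
  (mean I xstar - eps <= mean I r.1) && (r.2%:R <= bound)].
have [d0 d1] := andP delta01.
have KT_ge0 : 0 <= KT.
  by rewrite addr_ge0 // mulr_ge0 // addr_ge0 // !divr_ge0 // ltW.
have M_ge0 : 0 <= M by rewrite addr_ge0 ?mulr_ge0.
have L_ge0 : 0 <= L.
  by rewrite !addr_ge0 ?ln_ge0 ?ler1n // invf_ge1 // ltW.
pose G := cbar%:R * (`|Cest| * (KT * (M * L) * (2 * Num.sqrt #|X|%:R)
                                / (1 / 10)) * (M * L)).
pose C := `|Camp| * (KT * (204 * L) * (2 * Num.sqrt #|X|%:R) / 1) * (3 * L).
have boundE : bound = T0%:R * G + C by rewrite /bound /K /G /C; field.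
have G_ge0 : 0 <= G by rewrite !mulr_ge0 ?sqrtr_ge0 ?invr_ge0.
pose amp (ab : R * R) n := let eta := (ab.2 - ab.1) / 4 in
  run Q (amplify X Xi (flag_oracle xi0 X_gt0 qae (ab.1 - 3 / 4 * eta) eta
    (delta / 100)) (delta / 2)) n.
pose phi n (w : (R * R) * nat) : R :=
  prob (amp w.1 n) [pred r | E (r.1, (w.2 + r.2)%N)].
have phi_ge0 n w : 0 <= phi n w.
  by rewrite /phi probE; apply: expect_ge0 => //; apply: run_nonneg.
have d201 := half01 delta01.
have [] := two_stage_slack delta01.
set q := 1 - delta / 2 - delta ^+ 2 / 4 => q_ge0 q_slack.
have final_ok a b : region_ok eps (mean I xstar) a b -> b - a < eps / 2 ->
    exists n0, forall n, (n0 <= n)%N -> forall c : nat, c%:R <= T0%:R * G ->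
      q <= phi n ((a, b), c).
  move=> ok ab; have [n0 n0P] :=
    amplify_eventually qaeP amplifyP X_gt0 Y01 eps_gt0 delta01 QP ok ab.
  exists n0 => n n0n c cB; apply: le_trans (n0P n n0n) _.
  apply: le_prob => [|r /andP[rg rc]]; first exact: run_nonneg.
  by rewrite /= rg natrD boundE lerD.
have test_ok t a b e : (t < T0)%N -> region_ok eps (mean I xstar) a b ->
    eps / 2 <= b - a -> 0 < e -> _ :=
  @region_test_eventually _ _ _ _ _ qaeP estimateP _ _ xi0 X_gt0 _ _ Y01
    xstar_max _ _ eps_gt0 delta01 _ cbar T0 t a b e QbarP.
have ok01 : region_ok eps (mean I xstar) 0 1.
  have /andP[y0 y1] := mean01 (@Y01 xstar).
  by apply/and5P; split=> //; lra.
have len01 : 1 - 0 < eps / 2 + T0%:R * (5 * eps / 32) by lra.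
have [n0 n0P] := region_loop_ok eps_gt0 d201 G_ge0 q_ge0 phi_ge0 test_ok final_ok
  ok01 (leqnn T0 : (0 + T0 <= T0)%N) len01.
(* The same [n] is the fuel of the quantum programs and the bound on the rounds, so it must also
   reach [T0]. *)
pose n := maxn n0 T0.
have := n0P n n 0%N (leq_maxl _ _) (leq_maxr _ _).
rewrite add0r lexx expr0 divr1 => /(_ isT) le_n.
have sup_ge : ((prob (sogas xi0 X_gt0 Q Qbar cbar qae amplify estimate eps delta
    n) E)%:E <= Pr (sogas xi0 X_gt0 Q Qbar cbar qae amplify estimate eps delta)
    E)%E.
  by apply: ereal_sup_ubound; exists n.
apply: le_trans sup_ge; rewrite lee_fin.
apply: le_trans q_slack (le_trans le_n _); rewrite probE /sogas expect_bind.
apply: le_expect => [|[[a b] c]]; first exact: region_loop_nonneg.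
by rewrite /phi probE.
Qed.
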